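(* Consider the semi-random corruption model with corruption probability $p$. Assume that $r_{\bar x},r_{\bar y},r_{\bar z}$ are positive constants (independent of $n,m,l$) and let $r_{\bar w}:=r_{\bar x}r_{\bar y}r_{\bar z}$. Assume that, as $n,m,l\to\infty$, we have $nml\exp(-n)\to0$, $nml\exp(-m)\to0$ and $nml\exp(-l)\to 0$. If $p$ is a constant satisfying $$p<\frac{r_{\bar w}}{1+2r_{\bar w}},$$ then the flower LP (fLP) recovers the ground truth with high probability.
   Context: Write $[n]=\{1,\dots,n\}$. For vectors $x\in\mathbb R^n,y\in\mathbb R^m,z\in\mathbb R^l$, $x\otimes y\otimes z$ is the $n\times m\times l$ tensor with $(i,j,k)$ entry $x_iy_jz_k$. Fully-random corruption model: fix $\bar x\in\{0,1\}^n$, $\bar y\in\{0,1\}^m$, $\bar z\in\{0,1\}^l$; the ground truth is $\bar{\mathcal W}=\bar x\otimes\bar y\otimes\bar z$. Given $p\in[0,1]$, the random noisy binary tensor $\mathcal G=(g_{ijk})$ is obtained by corrupting each entry independently: $g_{ijk}=1-\bar x_i\bar y_j\bar z_k$ with probability $p$ and $g_{ijk}=\bar x_i\bar y_j\bar z_k$ with probability $1-p$. Semi-random corruption model: first $\mathcal G$ is generated by the fully-random model; then an adversary modifies $\mathcal G$ by an arbitrary sequence of monotone transformations, i.e. the adversary may choose any set of corrupted entries (entries where $\mathcal G$ differs from $\bar{\mathcal W}$) and revert them to their values in $\bar{\mathcal W}$. The resulting tensor is the input of the optimization problem. $r_{\bar x}$ (resp. $r_{\bar y}$, $r_{\bar z}$)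 is the ratio of the number of ones in $\bar x$ (resp. $\bar y$, $\bar z$) to its number of entries. Given an input binary tensor $\mathcal G=(g_{ijk})$, let $S_0=\{(i,j,k)\in[n]\times[m]\times[l]:g_{ijk}=0\}$ and $S_1=\{(i,j,k)\in[n]\times[m]\times[l]:g_{ijk}=1\}$. The flower LP (fLP), in variables $x\in\mathbb R^n,y\in\mathbb R^m,z\in\mathbb R^l,\mathcal W=(w_{ijk})\in\mathbb R^{n\times m\times l}$, is $$\begin{aligned}\min\ &\sum_{(i,j,k)\in S_0}w_{ijk}+\sum_{(i,j,k)\in S_1}(1-w_{ijk})\\ \text{s.t. }& w_{ijk}\le x_i,\ w_{ijk}\le y_j,\ w_{ijk}\le z_k,\quad\forall(i,j,k)\in S_1,\\ & w_{ijk}\ge0,\ w_{ijk}\ge x_i+y_j+z_k-2,\quad\forall(i,j,k)\in S_0,\\ & w_{i'jk}-w_{ijk}\le 1-x_i,\quad\forall(i,j,k)\in S_0,\ (i',j,k)\in S_1,\\ & w_{ij'k}-w_{ijk}\le 1-y_j,\quad\forall(i,j,k)\in S_0,\ (i,j',k)\in S_1,\\ & w_{ijk'}-w_{ijk}\le 1-z_k,\quad\forall(i,j,k)\in S_0,\ (i,j,k')\in S_1,\\ &(x,y,z)\in[0,1]^{n+m+l}.\end{aligned}$$ It recovers the ground truth if it has a unique optimal solution and this solution is $(\bar x,\bar y,\bar z,\bar{\mathcal W})$. ''With high probability'' means with probability tending to $1$ as $n,m,l\to\infty$ (along a family of instances whose three dimensions all go to infinity). *)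

(* Defs.v *)
From HB Require Import structures.
From mathcomp Require Import all_boot all_order all_algebra.
From mathcomp Require Import all_classical all_reals all_analysis.

Set Implicit Arguments.
Unset Strict Implicit.
Unset Printing Implicit Defensive.

Import Order.TTheory GRing.Theory Num.Theory.
Import numFieldNormedType.Exports.

Local Open Scope ring_scope.

Notation bvec n := {ffun 'I_n -> bool}.
Notation entry n m l := ('I_n * 'I_m * 'I_l)%type.
Notation btensor n m l := {ffun entry n m l -> bool}.

Definition ones_ratio (R : realType) (n : nat) (x : bvec n) : R :=
  #|[set i | x i]|%:R / n%:R.

Definition rank1 (n m l : nat) (x : bvec n) (y : bvec m) (z : bvec l) :
    btensor n m l :=
  [ffun e => [&& x e.1.1, y e.1.2 & z e.2]].

Section CorruptionModel.
Variables (R : realType) (n m l : nat) (W : btensor n m l).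

(* Each entry of [W] is flipped independently with probability [p], so the law
   of the noisy tensor is a product of Bernoulli laws. *)
Definition noise_pmf (p : R) (g : btensor n m l) : R :=
  \prod_(e : entry n m l) (if g e == W e then 1 - p else p).

Definition noise_prob (p : R) (E : btensor n m l -> Prop) : R :=
  \sum_(g : btensor n m l | `[< E g >]) noise_pmf p g.

Definition corrupted (g : btensor n m l) : {set entry n m l} :=
  [set e | g e != W e].

Definition revert (C : {set entry n m l}) (g : btensor n m l) : btensor n m l :=
  [ffun e => if e \in C then W e else g e].

(* The adversary sees the noisy tensor and selects the corrupted entries to
   revert; composing several monotone transformations again reverts one set of
   corrupted entries. *)
Definition monotone_adversary (A : btensor n m l -> {set entry n m l}) : Prop :=
  forall g, A g \subset corrupted g.

Definition adversarial_input (A : btensor n m l -> {set entry n m l})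
    (g : btensor n m l) : btensor n m l :=
  revert (A g) g.

End CorruptionModel.

Record lp_point (R : realType) (n m l : nat) := LPPoint {
  lp_x : {ffun 'I_n -> R};
  lp_y : {ffun 'I_m -> R};
  lp_z : {ffun 'I_l -> R};
  lp_w : {ffun entry n m l -> R} }.

Section FlowerLP.
Variables (R : realType) (n m l : nat) (g : btensor n m l).
Implicit Type s : lp_point R n m l.

Definition flp_objective s : R :=
  \sum_(e | ~~ g e) lp_w s e + \sum_(e | g e) (1 - lp_w s e).

Definition flp_feasible s : Prop :=
  let x := lp_x s in let y := lp_y s in let z := lp_z s in let w := lp_w s in
  [/\ (forall i j k, g (i, j, k) ->
         [/\ w (i, j, k) <= x i, w (i, j, k) <= y j & w (i, j, k) <= z k]),
      (forall i j k, ~~ g (i, j, k) ->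
         0 <= w (i, j, k) /\ x i + y j + z k - 2 <= w (i, j, k)),
      [/\ (forall i j k i', ~~ g (i, j, k) -> g (i', j, k) ->
             w (i', j, k) - w (i, j, k) <= 1 - x i),
          (forall i j k j', ~~ g (i, j, k) -> g (i, j', k) ->
             w (i, j', k) - w (i, j, k) <= 1 - y j) &
          (forall i j k k', ~~ g (i, j, k) -> g (i, j, k') ->
             w (i, j, k') - w (i, j, k) <= 1 - z k)] &
      [/\ (forall i, 0 <= x i <= 1), (forall j, 0 <= y j <= 1) &
          (forall k, 0 <= z k <= 1)]].

Definition flp_optimal s : Prop :=
  flp_feasible s /\
  forall s', flp_feasible s' -> flp_objective s <= flp_objective s'.

End FlowerLP.

Definition ground_truth (R : realType) (n m l : nat)
    (x : bvec n) (y : bvec m) (z : bvec l) : lp_point R n m l :=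
  LPPoint [ffun i => (x i)%:R] [ffun j => (y j)%:R] [ffun k => (z k)%:R]
    [ffun e => (rank1 x y z e)%:R].

Definition flp_recovers (R : realType) (n m l : nat)
    (x : bvec n) (y : bvec m) (z : bvec l) (g : btensor n m l) : Prop :=
  forall s : lp_point R n m l, flp_optimal g s <-> s = ground_truth R x y z.

(* Main.v *)
Require Import Defs.
From HB Require Import structures.
From mathcomp Require Import all_boot all_order all_algebra.
From mathcomp Require Import all_classical all_reals all_analysis.
From mathcomp Require Import ring lra.

(** Write [X], [Y], [Z] for the supports of the ground truth, [T] for the box
[X * Y * Z], [C] for the set of entries corrupted at random, [r = rx ry rz],
and put [u = 1 - x], [v = 1 - y], [t = 1 - z]. The gap of an entry is [1 - w]
on [T] and [w] outside. The objective exceeds its value at the ground truth by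
the sum of the gaps over the uncorrupted entries minus the sum over the
corrupted ones, so the point is to charge the corrupted gaps to the
uncorrupted ones with total load at most [lambda < 1].

Outside [T], a flower inequality moves a corrupted gap along a line to an
uncorrupted entry of the same region at the price of one of the numbers [u],
[v], [t]: entries with [i] outside [X] are moved along [j] into [Y], those
with [i] in [X] and [j] outside [Y] along [k] into [Z], and the remaining ones
along [i] into [X]. Inside [T], a corrupted gap is moved along [i] at the
price of [u i]. If every line had corruption density exactly [p], these moves
would cost [p / ((1 - p) r)] times the gaps outside [T] at most,
[p / (1 - p)] times the gaps in [T], and a combination of [u], [v], [t] that
the uncorrupted gaps of [T], each of which dominates its [u], [v] and [t], pay
at the rate [p / ((1 - p) r)]. The total rate is [p (1 + r) / ((1 - p) r)],
and it is less than 1 exactly when [p < r / (1 + 2 r)]: lemma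
[charge_budget].

Single lines need not have corruption density close to [p] with high
probability under the growth assumption: the constant in the exponent of the
tail bound is too small. Axis-parallel planes do, in the strong sense that
every rectangle of every plane has the expected number of corrupted entries
up to [eps] times the area of the plane ([regular], [noise_irregular]); this
is a union bound over [2 ^ (m + l)] rectangles against a probability
[exp (- c m l)]. It suffices because the corrupted gaps on a line are bounded
by one number per line, the least uncorrupted price on that line, capped by a
bound valid for the whole plane such as [x i]; a combination of
lines with weights in [[0, xi]] behaves like [xi] times a rectangle
([balanced_weight], [plane_charge]).

The adversary only shrinks the set of corrupted entries: a reverted entry of
[C] has nothing left to charge, and contributes a nonnegative gap to the
objective ([regular_recovers]). *)

Set Implicit Arguments.
Unset Strict Implicit.
Unset Printing Implicit Defensive.

Import Order.TTheory GRing.Theory Num.Theory.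
Import numFieldNormedType.Exports.

Local Open Scope ring_scope.

(** * Balanced matrices *)

Section Balanced.
Variable R : realFieldType.

(** The cut norm of [c - p] is at most [eps] times the area of the whole matrix;
an error relative to the rectangle itself would fail for thin rectangles. *)
Definition balanced (I J : finType) (p eps : R) (c : I -> J -> bool) : Prop :=
  forall (A : {set I}) (B : {set J}),
    `|\sum_(i in A) \sum_(j in B) ((c i j)%:R - p)| <= eps * #|I|%:R * #|J|%:R.

Lemma balanced_tr (I J : finType) (p eps : R) (c : I -> J -> bool) :
  balanced p eps c -> balanced p eps (fun j i => c i j).
Proof. by move=> cb A B; rewrite exchange_big mulrAC; exact: cb. Qed.

(** A linear form on the cube [[0, xi]] is largest at a vertex, that is, at [xi]
times the indicator of a set. *)
Lemma sum_weight_le (J : finType) (B : {set J}) (s b : J -> R) (D xi : R) :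
  (forall B' : {set J}, \sum_(j in B') s j <= D) -> 0 <= xi ->
  {in B, forall j, 0 <= b j <= xi} ->
  \sum_(j in B) s j * b j <= D * xi.
Proof.
move=> sD xi0 bB.
apply: (@le_trans _ _ (\sum_(j in B | 0 < s j) s j * xi)).
  rewrite big_mkcondr/=; apply: ler_sum => j /bB /andP[b0 bx].
  case: ltP => [s0|s0]; first by rewrite ler_wpM2l// ltW.
  by rewrite mulr_le0_ge0.
rewrite -mulr_suml ler_wpM2r//.
have -> : \sum_(j in B | 0 < s j) s j =
          \sum_(j in [set j in B | 0 < s j]%SET) s j.
  by apply: eq_bigl => j; rewrite inE.
exact: sD.
Qed.

Lemma balanced_weight (I J : finType) (p eps : R) (c : I -> J -> bool)
    (A : {set I}) (B : {set J}) (b : J -> R) (xi : R) :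
  balanced p eps c -> 0 <= xi -> {in B, forall j, 0 <= b j <= xi} ->
  `|\sum_(i in A) \sum_(j in B) ((c i j)%:R - p) * b j|
    <= eps * #|I|%:R * #|J|%:R * xi.
Proof.
move=> cb xi0 bB; rewrite exchange_big/=.
under eq_bigr do rewrite -mulr_suml.
rewrite ler_norml lerNl; apply/andP; split; last first.
  apply: sum_weight_le => // B'; rewrite exchange_big.
  exact: le_trans (ler_norm _) (cb _ _).
rewrite -sumrN; under eq_bigr do rewrite -mulNr.
apply: sum_weight_le => // B'; rewrite sumrN exchange_big.
by apply: le_trans (cb A B'); rewrite -normrN ler_norm.
Qed.

Lemma balanced_count (I J : finType) (p eps : R) (c : I -> J -> bool)
    (A : {set I}) (B : {set J}) :
  balanced p eps c ->
  `|\sum_(i in A) \sum_(j in B) (c i j)%:R - p * #|A|%:R * #|B|%:R|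
    <= eps * #|I|%:R * #|J|%:R.
Proof.
move=> /(_ A B); congr (`|_| <= _).
under eq_bigr do rewrite sumrB sumr_const.
by rewrite sumrB sumr_const -mulrnA -[p *+ _]mulr_natr natrM mulrA mulrAC.
Qed.

Lemma balanced_countC (I J : finType) (p eps : R) (c : I -> J -> bool)
    (A : {set I}) (B : {set J}) :
  balanced p eps c ->
  `|\sum_(i in A) \sum_(j in B) (~~ c i j)%:R - (1 - p) * #|A|%:R * #|B|%:R|
    <= eps * #|I|%:R * #|J|%:R.
Proof.
move=> /(_ A B); rewrite -normrN; congr (`|_| <= _).
have -> : \sum_(i in A) \sum_(j in B) (~~ c i j)%:R =
    \sum_(i in A) \sum_(j in B) (- ((c i j)%:R - p) + (1 - p)) :> R.
  by apply: eq_bigr => i _; apply: eq_bigr => j _; case: (c i j) => /=; ring.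
under [in RHS]eq_bigr do rewrite big_split sumrN sumr_const.
rewrite big_split sumrN sumr_const/= -mulrnA -[(1 - p) *+ _]mulr_natr natrM.
by ring.
Qed.

Lemma exists_uncorrupted (J K : finType) (p eps : R) (c : J -> K -> bool)
    (A : {set J}) (B : {set K}) :
  balanced p eps c ->
  eps * #|J|%:R * #|K|%:R < (1 - p) * #|A|%:R * #|B|%:R ->
  exists j k, [/\ j \in A, k \in B & ~~ c j k].
Proof.
move=> cb lt; have := balanced_countC A B cb.
rewrite ler_distl => /andP[+ _] => le.
have : 0 < \sum_(j in A) \sum_(k in B) (~~ c j k)%:R :> R.
  by apply: lt_le_trans le; rewrite subr_gt0.
apply: contraPP => no; apply/negP; rewrite -leNgt big1// => j jA.
rewrite big1// => k kB; case cjk: (c j k) => //.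
by case: no; exists j, k; rewrite jA kB cjk.
Qed.

(** The common price of a line: the largest number below the cap [xi] and below
all the values [h]. The cap makes it meaningful on a line where no [j]
satisfies [Q]. *)
Lemma line_min (J : finType) (Q : pred J) (h : J -> R) (xi : R) :
  0 <= xi -> (forall j, Q j -> 0 <= h j) ->
  exists b, [/\ 0 <= b <= xi, forall j, Q j -> b <= h j &
    forall y, y <= xi -> (forall j, Q j -> y <= h j) -> y <= b].
Proof.
move=> xi0 h0; exists (\big[Num.min/xi]_(j | Q j) h j).
have lb y : y <= xi -> (forall j, Q j -> y <= h j) ->
    y <= \big[Num.min/xi]_(j | Q j) h j.
  by move=> yx yh; elim/big_ind: _ => // a b ya yb; rewrite le_min ya.
split => //; first by rewrite lb//= bigmin_le_id.
by move=> j Qj; exact: bigmin_le_cond.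
Qed.

(** In one plane, with lines indexed by [k], each corrupted value on a line is at
most the price [b k] of that line. Balancedness replaces the number of
corrupted entries of a line in [J0] by [p |J0|], and the number of uncorrupted
ones in [Y] by [(1 - p) |Y|], on average against the weights [b]; the error
is proportional to the cap [xi]. *)
Lemma plane_charge (J K : finType) (p eps xi : R) (c : J -> K -> bool)
    (J0 Y : {set J}) (K0 : {set K}) (f : J -> K -> R) (v : J -> R) :
  0 <= p <= 1 -> 0 <= xi -> balanced p eps c ->
  (forall j, 0 <= v j) -> (forall j k, ~~ c j k -> 0 <= f j k) ->
  (forall j k, c j k -> f j k <= xi) ->
  (forall j j' k, j' \in Y -> c j k -> ~~ c j' k -> f j k <= v j' + f j' k) ->
  (1 - p) * #|Y|%:R * \sum_(j in J0) \sum_(k in K0) (c j k)%:R * f j k <=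
  p * #|J0|%:R * \sum_(j in Y) \sum_(k in K0) (~~ c j k)%:R * (v j + f j k) +
  (p * #|J0|%:R + (1 - p) * #|Y|%:R) * (eps * #|J|%:R * #|K|%:R * xi).
Proof.
move=> /andP[p0 p1] xi0 cb v0 f0 fxi fv.
have /(@choice _ _ _)[b bP] : forall k, exists b, [/\ 0 <= b <= xi,
    forall j, (j \in Y) && ~~ c j k -> b <= v j + f j k &
    forall y, y <= xi ->
      (forall j, (j \in Y) && ~~ c j k -> y <= v j + f j k) -> y <= b].
  by move=> k; apply: line_min => // j /andP[_ cjk]; rewrite addr_ge0 ?f0.
have bin : {in K0, forall k, 0 <= b k <= xi} by move=> k _; case: (bP k).
have b1 := balanced_weight J0 cb xi0 bin.
have b2 := balanced_weight Y cb xi0 bin.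
set D := eps * _ * _ * _ in b1 b2 *.
set s := \sum_(k in K0) b k.
have split (A : {set J}) : \sum_(j in A) \sum_(k in K0) ((c j k)%:R - p) * b k =
    \sum_(j in A) \sum_(k in K0) (c j k)%:R * b k - p * #|A|%:R * s.
  under eq_bigr => j _ do under eq_bigr => k _ do rewrite mulrBl.
  under eq_bigr do rewrite sumrB -mulr_sumr.
  by rewrite sumrB sumr_const -/s -[p * s *+ _]mulr_natr mulrAC.
have le1 : \sum_(j in J0) \sum_(k in K0) (c j k)%:R * f j k <=
    \sum_(j in J0) \sum_(k in K0) (c j k)%:R * b k.
  apply: ler_sum => j _; apply: ler_sum => k _.
  case cjk: (c j k); rewrite ?mul0r// !mul1r; case: (bP k) => _ _; apply.
    exact: fxi.
  by move=> j' /andP[j'Y cj']; exact: fv.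
have le2 : \sum_(j in Y) \sum_(k in K0) b k -
    \sum_(j in Y) \sum_(k in K0) (c j k)%:R * b k <=
    \sum_(j in Y) \sum_(k in K0) (~~ c j k)%:R * (v j + f j k).
  rewrite -sumrB; apply: ler_sum => j jY; rewrite -sumrB.
  apply: ler_sum => k _; case cjk: (c j k); rewrite /= ?mul0r ?mul1r ?subrr//.
  by rewrite subr0; case: (bP k) => _ + _; apply; rewrite jY cjk.
rewrite sumr_const -[_ *+ _]mulr_natr -/s in le2.
move: b1 b2; rewrite !split !ler_norml => /andP[_ b1] /andP[_ b2].
move: b1 b2 le1 le2.
set a1 := \sum_(j in J0) \sum_(k in K0) _ * b k.
set a2 := \sum_(j in Y) \sum_(k in K0) _ * b k.
set S := \sum_(j in J0) \sum_(k in K0) _ * f _ _.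
set F := \sum_(j in Y) \sum_(k in K0) _ * (_ + _).
have := ler0n R #|J0|; have := ler0n R #|Y|.
move: #|J0|%:R #|Y|%:R => x y y0 x0 b1 b2 le1 le2.
have h1 : S <= p * x * s + D by lra.
have h2 : (1 - p) * y * s <= F + D by lra.
have q0 : 0 <= 1 - p by lra.
have := ler_wpM2l (mulr_ge0 q0 y0) h1.
have := ler_wpM2l (mulr_ge0 p0 x0) h2.
lra.
Qed.

End Balanced.

(** * Charging outside the box *)

Section Regular.
Variable R : realFieldType.

Definition regular (I J K : finType) (p eps : R) (c : I -> J -> K -> bool) :=
  [/\ forall i, balanced p eps (c i),
      forall j, balanced p eps (fun i k => c i j k) &
      forall k, balanced p eps (fun i j => c i j k)].

Lemma regular_rot (I J K : finType) (p eps : R) (c : I -> J -> K -> bool) :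
  regular p eps c -> regular p eps (fun j k i => c i j k).
Proof. by move=> [ci cj ck]; split => // a; exact: balanced_tr. Qed.

Lemma ler_sum_setS (I : finType) (A B : {set I}) (h : I -> R) :
  A \subset B -> {in B, forall i, 0 <= h i} ->
  \sum_(i in A) h i <= \sum_(i in B) h i.
Proof.
move=> AB h0; rewrite [leRHS](big_setID A)/= (finset.setIidPr AB) lerDl.
by apply: sumr_ge0 => i; rewrite inE => /andP[_ /h0].
Qed.

(** What the linear program gives for a region where the coordinate [o] is
outside its support. The number [xi o] is the variable of [o] itself: it caps
the corrupted values of the slice, and the lower bound on uncorrupted entries
makes every uncorrupted entry of [Y * K1] pay for it. *)
Definition outer_bounds (O J K : finType) (c : O -> J -> K -> bool)
    (O0 : {set O}) (Y : {set J}) (K1 : {set K}) (f : O -> J -> K -> R)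
    (v : J -> R) (t : K -> R) (xi : O -> R) :=
  [/\ forall o, 0 <= xi o,
      forall o j k, o \in O0 -> c o j k -> f o j k <= xi o,
      forall o j j' k, o \in O0 -> j' \in Y -> c o j k -> ~~ c o j' k ->
        f o j k <= v j' + f o j' k &
      forall o j k, o \in O0 -> j \in Y -> k \in K1 -> ~~ c o j k ->
        xi o <= v j + t k + f o j k].

(** Summing [plane_charge] over the slices [o], the load on each [v j] is the
number of uncorrupted entries of a rectangle in the slice [j], which is
again controlled by balancedness. The caps [xi o], which come with a factor
[eps], are averaged over the uncorrupted entries of [Y * K1]. The three outer
regions of the tensor are instances up to a cyclic rotation, which is why
sources ([J0], [K0]) and targets ([Y], [K1]) are separate. *)
Lemma region_charge (O J K : finType) (p eps rho rj ry rk : R)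
    (c : O -> J -> K -> bool) (O0 : {set O}) (J0 Y : {set J})
    (K0 K1 : {set K}) (f : O -> J -> K -> R)
    (v : J -> R) (t : K -> R) (xi : O -> R) :
  0 <= p <= 1 -> 0 <= eps <= rho / 2 -> regular p eps c ->
  (0 < #|J|)%N ->
  #|J0|%:R = rj * #|J|%:R -> #|Y|%:R = ry * #|J|%:R ->
  #|K1|%:R = rk * #|K|%:R -> rj <= 1 -> 0 <= ry <= 1 -> rk <= 1 ->
  0 < rho <= (1 - p) * ry * rk ->
  Y \subset J0 -> K1 \subset K0 ->
  (forall j, 0 <= v j) -> (forall k, 0 <= t k) ->
  (forall o j k, ~~ c o j k -> 0 <= f o j k) ->
  outer_bounds c O0 Y K1 f v t xi ->
  \sum_(o in O0) \sum_(j in J0) \sum_(k in K0) (c o j k)%:R * f o j k <=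
  p * rj / ((1 - p) * ry) * \sum_(o in O0) \sum_(j in J0) \sum_(k in K0)
    (~~ c o j k)%:R * f o j k +
  p * rj / ry * (#|O0|%:R * #|K0|%:R * \sum_(j in Y) v j) +
  3 * eps / rho ^+ 2 *
    (#|O|%:R * #|K|%:R * \sum_(j in Y) v j +
     #|O|%:R * #|J|%:R * \sum_(k in K1) t k +
     \sum_(o in O0) \sum_(j in J0) \sum_(k in K0) (~~ c o j k)%:R * f o j k).
Proof.
move=> p01 /andP[e0 erho] [cO cJ _] J_gt0 J0E YE K1E rj1 /andP[ry0 ry1] rk1.
move=> /andP[rho0 rhoq] YJ KK v0 t0 f0 [xi0 fxi fv xif].
set sv := \sum_(j in Y) v j; set st := \sum_(k in K1) t k.
set F := \sum_(o in O0) \sum_(j in J0) \sum_(k in K0) (~~ _)%:R * _.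
have /andP[p0 p1] := p01.
have nj : 0 < #|J|%:R :> R by rewrite ltr0n.
have ncf_ge0 o j k : 0 <= (~~ c o j k)%:R * f o j k.
  by case cojk: (c o j k); rewrite ?mul0r//= mul1r f0// cojk.
set S := \sum_(o in O0) _.
pose V := \sum_(o in O0) \sum_(j in Y) \sum_(k in K0) (~~ c o j k)%:R * v j.
pose X := \sum_(o in O0) xi o.
have svge0 : 0 <= sv by apply: sumr_ge0.
have stge0 : 0 <= st by apply: sumr_ge0.
have Xge0 : 0 <= X by apply: sumr_ge0.
have subF (K2 : {set K}) : K2 \subset K0 ->
    \sum_(o in O0) \sum_(j in Y) \sum_(k in K2) (~~ c o j k)%:R * f o j k <= F.
  move=> K2K; apply: ler_sum => o _; apply: le_trans (ler_sum_setS YJ _).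
    by apply: ler_sum => j _; exact: ler_sum_setS.
  by move=> j _; apply: sumr_ge0.
have S_le : (1 - p) * ry * S <= p * rj * (V + F) +
    (p * rj + (1 - p) * ry) * (eps * #|J|%:R * #|K|%:R * X).
  rewrite -(ler_pM2l nj) [leRHS]mulrDr.
  have -> : #|J|%:R * ((1 - p) * ry * S) = \sum_(o in O0) (1 - p) * #|Y|%:R *
      \sum_(j in J0) \sum_(k in K0) (c o j k)%:R * f o j k.
    by rewrite -mulr_sumr YE -/S; ring.
  apply: (@le_trans _ _ (\sum_(o in O0) (p * #|J0|%:R *
      \sum_(j in Y) \sum_(k in K0) (~~ c o j k)%:R * (v j + f o j k) +
      (p * #|J0|%:R + (1 - p) * #|Y|%:R) *
        (eps * #|J|%:R * #|K|%:R * xi o)))).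
    apply: ler_sum => o oO; apply: plane_charge => //.
    - exact: f0.
    - by move=> j k; exact: fxi.
    - by move=> j j' k; exact: fv.
  rewrite big_split/= -!mulr_sumr -/X J0E YE.
  apply: lerD; last by rewrite le_eqVlt; apply/orP; left; apply/eqP; ring.
  rewrite [leRHS]mulrA [#|J|%:R * _]mulrC -[p * rj * _]mulrA.
  apply: ler_wpM2l.
    by rewrite -J0E mulr_ge0.
  apply: le_trans (lerD (lexx V) (subF _ (subxx _))).
  rewrite -big_split/=; apply: ler_sum => o _.
  rewrite -big_split/=; apply: ler_sum => j _.
  rewrite -big_split/=; apply: ler_sum => k _.
  by rewrite mulrDr.
have V_le : V <= sv * ((1 - p) * #|O0|%:R * #|K0|%:R + eps * #|O|%:R * #|K|%:R).
  rewrite /V exchange_big mulr_suml; apply: ler_sum => j _ /=.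
  under eq_bigr do rewrite -mulr_suml.
  rewrite -mulr_suml mulrC ler_wpM2l//.
  have := balanced_countC O0 K0 (cJ j).
  by rewrite ler_distl => /andP[_]; rewrite addrC [leRHS]addrC.
set G := _ + _ + F.
have X_le : rho / 2 * (#|J|%:R * #|K|%:R * X) <= G.
  have le1 : ((1 - p) * #|Y|%:R * #|K1|%:R - eps * #|J|%:R * #|K|%:R) * X <=
      \sum_(o in O0) \sum_(j in Y) \sum_(k in K1)
         (~~ c o j k)%:R * (v j + t k + f o j k).
    rewrite mulr_sumr; apply: ler_sum => o oO.
    have := balanced_countC Y K1 (cO o).
    rewrite ler_distl => /andP[+ _] => /(ler_wpM2r (xi0 o))/le_trans; apply.
    rewrite mulr_suml; apply: ler_sum => j jY.
    rewrite mulr_suml; apply: ler_sum => k kK.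
    case cojk: (c o j k); rewrite ?mul0r ?mul1r//=.
    by apply: xif => //; rewrite cojk.
  have le2 : \sum_(o in O0) \sum_(j in Y) \sum_(k in K1)
         (~~ c o j k)%:R * (v j + t k + f o j k) <= G.
    apply: (@le_trans _ _ (\sum_(o in O0) \sum_(j in Y) \sum_(k in K1)
         (v j + t k + (~~ c o j k)%:R * f o j k))).
      apply: ler_sum => o _; apply: ler_sum => j _; apply: ler_sum => k _.
      rewrite mulrDr lerD2r ler_piMl ?addr_ge0//.
      by case: (c o j k).
    under eq_bigr do under eq_bigr do rewrite big_split.
    under eq_bigr do rewrite big_split.
    rewrite big_split/=; apply: lerD; last exact: subF.
    have -> : \sum_(o in O0) \sum_(j in Y) \sum_(k in K1) (v j + t k) =
        #|O0|%:R * (#|K1|%:R * sv + #|Y|%:R * st).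
      rewrite sumr_const mulr_natl; congr (_ *+ _).
      under eq_bigr do rewrite big_split/= sumr_const -[v _ *+ _]mulr_natl -/st.
      by rewrite big_split/= -mulr_sumr sumr_const -[st *+ _]mulr_natl.
    rewrite mulrDr !mulrA.
    by apply: lerD; apply: ler_wpM2r => //; apply: ler_pM => //;
      rewrite ler_nat max_card.
  apply: le_trans (le_trans le1 le2); rewrite YE K1E.
  rewrite !mulrA; apply: ler_wpM2r => //.
  have -> : (1 - p) * ry * #|J|%:R * rk * #|K|%:R - eps * #|J|%:R * #|K|%:R =
    ((1 - p) * ry * rk - eps) * #|J|%:R * #|K|%:R by ring.
  rewrite -[leLHS]mulrA -[leRHS]mulrA.
  by apply: ler_wpM2r; [rewrite mulr_ge0 | lra].
have qry : rho <= (1 - p) * ry.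
  apply: le_trans rhoq _; rewrite ler_piMr// mulr_ge0//; lra.
have qry1 : (1 - p) * ry <= 1 by rewrite mulr_ile1//; lra.
have qry0 : 0 < (1 - p) * ry by lra.
have rj0 : 0 <= rj by rewrite -(pmulr_lge0 _ nj) -J0E.
set NX := #|J|%:R * #|K|%:R * X in X_le.
have NX0 : 0 <= NX by rewrite !mulr_ge0.
have F0 : 0 <= F by do 3!(apply: sumr_ge0 => ? _).
have G0 : 0 <= G by rewrite !addr_ge0// !mulr_ge0.
have ryN0 : ry != 0 by apply: contraTneq qry0 => ->; rewrite mulr0 ltxx.
have qN0 : 1 - p != 0 by apply: contraTneq qry0 => ->; rewrite mul0r ltxx.
have svG : #|O|%:R * #|K|%:R * sv <= G.
  by rewrite /G -addrA lerDl addr_ge0// !mulr_ge0.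
have prj : p * rj <= p by rewrite ler_piMr.
have h1 : (1 - p) * ry * S <= p * rj * F +
    p * rj * (1 - p) * (#|O0|%:R * #|K0|%:R * sv) + eps * G + eps * NX.
  apply: le_trans S_le _.
  have le1 : p * rj * V <= p * rj * (1 - p) * (#|O0|%:R * #|K0|%:R * sv) +
      eps * G.
    apply: le_trans (ler_wpM2l (mulr_ge0 p0 rj0) V_le) _.
    rewrite mulrDr mulrDr; apply: lerD.
      by rewrite le_eqVlt; apply/orP; left; apply/eqP; ring.
    have -> : p * rj * (sv * (eps * #|O|%:R * #|K|%:R)) =
       p * rj * (eps * (#|O|%:R * #|K|%:R * sv)) by ring.
    apply: (@le_trans _ _ (eps * (#|O|%:R * #|K|%:R * sv))).
      by apply: ler_piMl; [rewrite !mulr_ge0 | lra].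
    exact: ler_wpM2l.
  have le2 : (p * rj + (1 - p) * ry) * (eps * #|J|%:R * #|K|%:R * X) <= eps * NX.
    rewrite -!mulrA ![#|J|%:R * _]mulrA -/NX.
    apply: ler_piMl; rewrite ?mulr_ge0//.
    have : (1 - p) * ry <= (1 - p) by rewrite ler_piMr//; lra.
    lra.
  by rewrite mulrDr; lra.
have NXG : NX <= 2 / rho * G.
  rewrite -(ler_pM2l (_ : 0 < rho / 2)); last by rewrite divr_gt0.
  have -> : rho / 2 * (2 / rho * G) = G by field; rewrite gt_eqF.
  exact: X_le.
have -> : p * rj / ((1 - p) * ry) * F + p * rj / ry * (#|O0|%:R * #|K0|%:R * sv)
  = ((1 - p) * ry)^-1 * (p * rj * F +
      p * rj * (1 - p) * (#|O0|%:R * #|K0|%:R * sv)).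
  by field; apply/andP; split.
rewrite -(ler_pM2l qry0) mulrDr mulVKf ?gt_eqF//.
apply: le_trans h1 _; rewrite -[leLHS]addrA lerD2l.
apply: (@le_trans _ _ (eps * (3 / rho * G))).
  rewrite -mulrDr ler_wpM2l//.
  have rho1 : 1 <= rho^-1 by rewrite -invr1 lef_pV2 ?posrE// (le_trans qry).
  have : G <= rho^-1 * G by rewrite ler_peMl.
  have -> : 3 / rho * G = rho^-1 * G + 2 / rho * G by ring.
  by lra.
have -> : (1 - p) * ry * (3 * eps / rho ^+ 2 * G) =
  (1 - p) * ry * (rho^-1 * (eps * (3 / rho * G))) by field; rewrite gt_eqF.
rewrite [leRHS]mulrA ler_peMl//; last by rewrite ler_pdivlMr// mul1r.
by rewrite mulr_ge0// mulr_ge0// divr_ge0// ltW.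
Qed.

End Regular.

(** * Charging inside the box, and the balance *)

Section Charging.
Variable R : realFieldType.

Lemma box_rot (I J K : finType) (X : {set I}) (Y : {set J}) (Z : {set K})
    (h : I -> J -> K -> R) :
  \sum_(i in X) \sum_(j in Y) \sum_(k in Z) h i j k =
  \sum_(j in Y) \sum_(k in Z) \sum_(i in X) h i j k.
Proof.
by rewrite exchange_big; apply: eq_bigr => j _; rewrite exchange_big.
Qed.

Lemma sum_setC (I : finType) (X : {set I}) (h : I -> R) :
  \sum_(i in [set: I]) h i = \sum_(i in ~: X) h i + \sum_(i in X) h i.
Proof. by rewrite (big_setID X) finset.setTI finset.setTD/= addrC. Qed.

(** The three outer regions are written with their outside coordinate first, as
in [region_charge]. *)
Lemma box_split (I J K : finType) (X : {set I}) (Y : {set J}) (Z : {set K})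
    (h : I -> J -> K -> R) :
  \sum_i \sum_j \sum_k h i j k =
  \sum_(i in ~: X) \sum_(j in [set: J]) \sum_(k in [set: K]) h i j k +
  \sum_(j in ~: Y) \sum_(k in [set: K]) \sum_(i in X) h i j k +
  \sum_(k in ~: Z) \sum_(i in X) \sum_(j in Y) h i j k +
  \sum_(i in X) \sum_(j in Y) \sum_(k in Z) h i j k.
Proof.
transitivity (\sum_(i in [set: I]) \sum_(j in [set: J]) \sum_(k in [set: K])
  h i j k).
  apply: eq_big => [i|i _]; first by rewrite inE.
  apply: eq_big => [j|j _]; first by rewrite inE.
  by apply: eq_bigl => k; rewrite inE.
rewrite (sum_setC X) -!addrA; congr (_ + _).
rewrite [LHS]box_rot (sum_setC Y); congr (_ + _).
rewrite [LHS]box_rot (sum_setC Z); congr (_ + _).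
by rewrite -box_rot.
Qed.

(** Here the price of the line [(j, k)] has cap [v j + t k], which is not
constant on a plane. It is split into a part below [v j] and a part below
[t k], and balancedness is used in the slice [j] for the former, in the slice
[k] for the latter. *)
Lemma inside_charge (I J K : finType) (p eps : R) (c : I -> J -> K -> bool)
    (X : {set I}) (Y : {set J}) (Z : {set K}) (f : I -> J -> K -> R)
    (u : I -> R) (v : J -> R) (t : K -> R) :
  0 <= p < 1 -> regular p eps c ->
  (forall i, 0 <= u i) -> (forall j, 0 <= v j) -> (forall k, 0 <= t k) ->
  (forall i j k, ~~ c i j k -> 0 <= f i j k) ->
  (forall i j k, i \in X -> j \in Y -> k \in Z -> c i j k ->
     f i j k <= u i + (v j + t k)) ->
  (forall i i' j k, i \in X -> i' \in X -> j \in Y -> k \in Z ->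
     c i j k -> ~~ c i' j k -> f i j k <= u i + f i' j k) ->
  \sum_(i in X) \sum_(j in Y) \sum_(k in Z) (c i j k)%:R * f i j k <=
  p / (1 - p) *
    \sum_(i in X) \sum_(j in Y) \sum_(k in Z) (~~ c i j k)%:R * f i j k +
  (p * #|Y|%:R * #|Z|%:R + eps * #|J|%:R * #|K|%:R) * \sum_(i in X) u i +
  eps / (1 - p) * (#|I|%:R * #|K|%:R * \sum_(j in Y) v j +
                   #|I|%:R * #|J|%:R * \sum_(k in Z) t k).
Proof.
move=> /andP[p0 p1] [cI cJ cK] u0 v0 t0 f0 fuvt fu.
have /(@choice _ _ _)[b bP] : forall jk : J * K, exists b,
    [/\ 0 <= b <= v jk.1 + t jk.2,
    forall i, (i \in X) && ~~ c i jk.1 jk.2 -> b <= f i jk.1 jk.2 &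
    forall y, y <= v jk.1 + t jk.2 -> (forall i, (i \in X) &&
      ~~ c i jk.1 jk.2 -> y <= f i jk.1 jk.2) -> y <= b].
  move=> [j k]; apply: line_min => [|i /andP[_ cijk]]; last exact: f0.
  exact: addr_ge0.
pose b1 j k := Num.min (b (j, k)) (v j).
pose b2 j k := b (j, k) - b1 j k.
have b1P j k : 0 <= b1 j k <= v j.
  rewrite /b1 ge_min lexx orbT le_min v0 !andbT.
  by case: (bP (j, k)) => /andP[].
have b2P j k : 0 <= b2 j k <= t k.
  rewrite /b2 /b1; case: (bP (j, k)) => /andP[_ /=] + _ _ => bjk.
  case: (leP (b (j, k)) (v j)) => [_|/ltW vb]; first by rewrite subrr lexx t0.
  by rewrite subr_ge0 vb lerBlDl.
have e1 : \sum_(i in X) \sum_(j in Y) \sum_(k in Z)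
    ((c i j k)%:R - p) * b (j, k) <=
    eps * #|I|%:R * #|K|%:R * \sum_(j in Y) v j +
    eps * #|I|%:R * #|J|%:R * \sum_(k in Z) t k.
  have -> : \sum_(i in X) \sum_(j in Y) \sum_(k in Z)
      ((c i j k)%:R - p) * b (j, k) =
      \sum_(j in Y) \sum_(i in X) \sum_(k in Z) ((c i j k)%:R - p) * b1 j k +
      \sum_(k in Z) \sum_(i in X) \sum_(j in Y) ((c i j k)%:R - p) * b2 j k.
    rewrite [X in _ = _ + X]box_rot [X in _ = X + _]exchange_big -big_split/=.
    apply: eq_bigr => i _; rewrite -big_split/=; apply: eq_bigr => j _.
    rewrite -big_split/=; apply: eq_bigr => k _.
    by rewrite -mulrDr /b2 [X in _ = _ * X]addrCA subrr addr0.
  rewrite !mulr_sumr; apply: lerD; apply: ler_sum => a _.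
    apply: le_trans (ler_norm _) _.
    by apply: (balanced_weight X (cJ a)) => // k _; exact: b1P.
  apply: le_trans (ler_norm _) _.
  by apply: (balanced_weight X (cK a)) => // j _; exact: b2P.
set D := _ + _ in e1.
pose Sc := \sum_(i in X) \sum_(j in Y) \sum_(k in Z) (c i j k)%:R * b (j, k).
pose Sn := \sum_(i in X) \sum_(j in Y) \sum_(k in Z) (~~ c i j k)%:R * b (j, k).
set F := \sum_(i in X) \sum_(j in Y) \sum_(k in Z) (~~ _)%:R * _.
have SnF : Sn <= F.
  apply: ler_sum => i iX; apply: ler_sum => j _; apply: ler_sum => k _.
  case cijk: (c i j k); rewrite ?mul0r ?mul1r//=.
  by case: (bP (j, k)) => _ + _; apply; rewrite iX cijk.
have ScSn : (1 - p) * Sc - p * Sn <= D.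
  apply: le_trans e1; rewrite le_eqVlt; apply/orP; left; apply/eqP.
  rewrite !mulr_sumr -sumrB; apply: eq_bigr => i _.
  rewrite !mulr_sumr -sumrB; apply: eq_bigr => j _.
  rewrite !mulr_sumr -sumrB; apply: eq_bigr => k _.
  by case: (c i j k) => /=; ring.
have Sle : \sum_(i in X) \sum_(j in Y) \sum_(k in Z) (c i j k)%:R * f i j k <=
    \sum_(i in X) \sum_(j in Y) \sum_(k in Z) (c i j k)%:R * u i + Sc.
  rewrite -big_split/=; apply: ler_sum => i iX.
  rewrite -big_split/=; apply: ler_sum => j jY.
  rewrite -big_split/=; apply: ler_sum => k kZ.
  case cijk: (c i j k); rewrite ?mul0r ?addr0// !mul1r -lerBlDl.
  case: (bP (j, k)) => _ _; apply => /= [|i' /andP[i'X ci']].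
    by rewrite lerBlDl; exact: fuvt.
  by rewrite lerBlDl; exact: fu.
have Ule : \sum_(i in X) \sum_(j in Y) \sum_(k in Z) (c i j k)%:R * u i <=
    (p * #|Y|%:R * #|Z|%:R + eps * #|J|%:R * #|K|%:R) * \sum_(i in X) u i.
  rewrite mulr_sumr; apply: ler_sum => i _.
  under eq_bigr do rewrite -mulr_suml.
  rewrite -mulr_suml ler_wpM2r//.
  have := balanced_count Y Z (cI i).
  by rewrite ler_distl => /andP[_].
apply: le_trans Sle _; rewrite [leLHS]addrC [leRHS]addrAC.
apply: lerD => //.
have q0 : 0 < 1 - p by rewrite subr_gt0.
rewrite -(ler_pM2l q0) mulrDr.
have -> : (1 - p) * (p / (1 - p) * F) = p * F by field; rewrite gt_eqF.
set G := (X in eps / (1 - p) * X).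
have -> : (1 - p) * (eps / (1 - p) * G) = eps * G by field; rewrite gt_eqF.
have DG : D = eps * G by rewrite /D /G; ring.
have := ler_wpM2l p0 SnF.
by rewrite -DG; lra.
Qed.

Lemma slice_lower (I J K : finType) (p eps : R) (c : I -> J -> K -> bool)
    (X : {set I}) (Y : {set J}) (Z : {set K}) (u : I -> R) :
  regular p eps c -> (forall i, 0 <= u i) ->
  ((1 - p) * #|Y|%:R * #|Z|%:R - eps * #|J|%:R * #|K|%:R) * \sum_(i in X) u i
  <= \sum_(i in X) \sum_(j in Y) \sum_(k in Z) (~~ c i j k)%:R * u i.
Proof.
move=> [cI _ _] u0; rewrite mulr_sumr; apply: ler_sum => i _.
under eq_bigr do rewrite -mulr_suml.
rewrite -mulr_suml ler_wpM2r//.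
by have := balanced_countC Y Z (cI i); rewrite ler_distl => /andP[].
Qed.

(** The balance sheet. [PU] is the sum of [u i] over the triples with [i] in [X]
and [j], [k] arbitrary, and similarly for [PV], [PT]; [SA], [SB], [SC], [SD]
and [FA], [FB], [FC], [FD] are the corrupted and uncorrupted sums of the three
outer regions and of the box. The loads on [u], [v], [t] add up to [p] times
[(1 - rx) / ry * PV + (1 - ry) * rx / rz * PT + ry * PU]; the box pays for it
when each of its gaps is bounded below by the average of [u], [v], [t] with
the weights [rx ry], [1 - rx], [rx (1 - ry)], which sum to 1. *)
Lemma charge_budget (p eps rho rx ry rz : R)
    (PU PV PT SA SB SC SD FA FB FC FD : R) :
  0 <= p < 1 -> 0 <= eps -> 0 < rx <= 1 -> 0 < ry <= 1 -> 0 < rz <= 1 ->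
  rho = (1 - p) * (rx * ry * rz) ->
  [/\ 0 <= PU, 0 <= PV & 0 <= PT] -> [/\ 0 <= FA, 0 <= FB & 0 <= FC] ->
  SA <= p / ((1 - p) * ry) * FA + p / ry * (1 - rx) * PV +
    3 * eps / rho ^+ 2 * (PV + PT + FA) ->
  SB <= p / ((1 - p) * rz) * FB + p / rz * ((1 - ry) * rx) * PT +
    3 * eps / rho ^+ 2 * (PT + PU + FB) ->
  SC <= p / (1 - p) * FC + p * ((1 - rz) * ry) * PU +
    3 * eps / rho ^+ 2 * (PU + PV + FC) ->
  SD <= p / (1 - p) * FD + (p * ry * rz + eps) * PU +
    eps / (1 - p) * (PV + PT) ->
  rx * ry * (((1 - p) * ry * rz - eps) * PU) +
    (1 - rx) * (((1 - p) * rx * rz - eps) * PV) +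
    rx * (1 - ry) * (((1 - p) * rx * ry - eps) * PT) <= FD ->
  [/\ rho / 2 * PU <= FD, rho / 2 * PV <= FD & rho / 2 * PT <= FD] ->
  SA + SB + SC + SD <=
  (p * (1 + rx * ry * rz) / rho + 75 * eps / rho ^+ 3) * (FA + FB + FC + FD).
Proof.
move=> /andP[p0 p1] e0 /andP[rx0 rx1] /andP[ry0 ry1] /andP[rz0 rz1] rhoE.
move=> [PU0 PV0 PT0] [FA0 FB0 FC0] hA hB hC hD hF [hU hV hT].
have [[rx0w ry0w] rz0w] := (ltW rx0, ltW ry0, ltW rz0).
have q0 : 0 < 1 - p by rewrite subr_gt0.
have [q0w p1w] := (ltW q0, ltW p1).
have q1 : 1 - p <= 1 by rewrite lerBlDr lerDl.
set r := rx * ry * rz in rhoE *.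
have r0 : 0 < r by rewrite /r !mulr_gt0.
have rho0 : 0 < rho by rewrite rhoE mulr_gt0.
have [r0w rho0w] := (ltW r0, ltW rho0).
have ryr : r <= ry by rewrite /r mulrAC ler_piMl// mulr_ile1.
have rzr : r <= rz by rewrite /r ler_piMl// mulr_ile1.
have r1 : r <= 1 by exact: le_trans rzr rz1.
have rho1 : rho <= 1 by rewrite rhoE mulr_ile1//.
have rhoq : rho <= 1 - p by rewrite rhoE ler_piMr//.
have i1 : 1 <= rho^-1 by rewrite -invr1 lef_pV2 ?posrE.
set E := 3 * eps / rho ^+ 2 in hA hB hC.
have epsE : eps / rho <= E / 3.
  have -> : E / 3 = rho^-1 * (eps / rho) by rewrite /E; field; rewrite gt_eqF.
  by rewrite ler_peMl// divr_ge0//.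
have E0 : 0 <= E by rewrite /E divr_ge0 ?mulr_ge0 ?exprn_ge0.
set th := p / rho.
have th0 : 0 <= th by rewrite divr_ge0.
have cA : p / ((1 - p) * ry) * FA <= th * FA.
  by rewrite ler_wpM2r// ler_wpM2l// lef_pV2 ?posrE ?mulr_gt0// rhoE ler_pM2l.
have cB : p / ((1 - p) * rz) * FB <= th * FB.
  by rewrite ler_wpM2r// ler_wpM2l// lef_pV2 ?posrE ?mulr_gt0// rhoE ler_pM2l.
have cC : p / (1 - p) * FC <= th * FC.
  by rewrite ler_wpM2r// ler_wpM2l// lef_pV2 ?posrE.
(* the load on [u], [v], [t], divided by [p] *)
pose L := (1 - rx) / ry * PV + (1 - ry) * rx / rz * PT + ry * PU.
pose P := PU + PV + PT.
have P0 : 0 <= P by rewrite !addr_ge0.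
have hL : p * L <= th * (FD + eps * P).
  have -> : p * L = th * (rho * L).
    by rewrite /th; field; rewrite gt_eqF.
  apply: ler_wpM2l => //.
  have -> : rho * L = rx * ry * ((1 - p) * ry * rz) * PU +
      (1 - rx) * ((1 - p) * rx * rz) * PV +
      rx * (1 - ry) * ((1 - p) * rx * ry) * PT.
    by rewrite rhoE /L /r; field; apply/andP; split; rewrite gt_eqF.
  have k1 : rx * ry * (eps * PU) <= eps * PU.
    by rewrite ler_piMl ?mulr_ge0// mulr_ile1.
  have k2 : (1 - rx) * (eps * PV) <= eps * PV.
    by rewrite ler_piMl ?mulr_ge0// lerBlDr lerDl.
  have k3 : rx * (1 - ry) * (eps * PT) <= eps * PT.
    rewrite ler_piMl ?mulr_ge0// mulr_ile1//; first by rewrite subr_ge0.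
    by rewrite lerBlDr lerDl.
  rewrite /P; lra.
have the : th * (eps * P) <= E / 3 * P.
  have -> : th * (eps * P) = p * (eps / rho * P) by rewrite /th; ring.
  apply: (@le_trans _ _ (eps / rho * P)); last by rewrite ler_wpM2r.
  by rewrite ler_piMl ?mulr_ge0 ?invr_ge0.
have qE : eps / (1 - p) <= E / 3.
  by apply: le_trans epsE; rewrite ler_wpM2l// lef_pV2 ?posrE.
have hq : eps * PU + eps / (1 - p) * (PV + PT) <= E / 3 * P.
  have epsE3 : eps <= E / 3.
    by apply: le_trans epsE; rewrite ler_peMr.
  have k1 := ler_wpM2r PU0 epsE3.
  have k2 := ler_wpM2r (addr_ge0 PV0 PT0) qE.
  by rewrite /P -[PU + _ + _]addrA [leRHS]mulrDr lerD.
have hP : E * P <= 6 * (E / rho) * FD.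
  have : rho / 2 * P <= 3 * FD by rewrite /P; lra.
  have Er : 0 <= 2 * (E / rho) by rewrite mulr_ge0// divr_ge0//.
  move=> /(ler_wpM2l Er); congr (_ <= _); last by ring.
  by field; rewrite gt_eqF.
have FD0 : 0 <= FD by apply: le_trans hU; rewrite mulr_ge0// divr_ge0//.
have Erho : E <= E / rho by rewrite ler_peMr.
have k1 := ler_wpM2r (addr_ge0 (addr_ge0 FA0 FB0) FC0) Erho.
have thr0 : 0 <= th * r by rewrite mulr_ge0//.
have thr : p / (1 - p) = th * r.
  by rewrite /th rhoE; field; rewrite !gt_eqF.
have -> : p * (1 + r) / rho + 75 * eps / rho ^+ 3 =
    th + th * r + 25 * (E / rho).
  by rewrite /th /E; field; rewrite gt_eqF.
have Erho0 : 0 <= E / rho by rewrite divr_ge0//.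
have k2 := mulr_ge0 Erho0 FD0.
have k3 := mulr_ge0 Erho0 (addr_ge0 (addr_ge0 FA0 FB0) FC0).
have k4 := mulr_ge0 thr0 (addr_ge0 (addr_ge0 FA0 FB0) FC0).
have LE : p * L = p / ry * (1 - rx) * PV + p / rz * ((1 - ry) * rx) * PT +
    p * ((1 - rz) * ry) * PU + p * ry * rz * PU.
  by rewrite /L; ring.
rewrite thr in hD.
have EPE : E * P = E * PU + E * PV + E * PT by rewrite /P; ring.
rewrite -/th.
apply: (@le_trans _ _ (th * (FA + FB + FC) + th * r * FD + p * L +
  (2 * (E * P) + E * (FA + FB + FC)) + E / 3 * P)).
  rewrite EPE LE; lra.
lra.
Qed.

End Charging.

Section Tensor.
Variable R : realFieldType.

Lemma ratio_le1 (T : finType) (A : {set T}) (r : R) :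
  (0 < #|T|)%N -> #|A|%:R = r * #|T|%:R -> r <= 1.
Proof.
move=> T0 AE; rewrite -(ler_pM2r (_ : 0 < #|T|%:R)) ?ltr0n// -AE mul1r.
by rewrite ler_nat max_card.
Qed.

(** The charging inequality on the whole tensor, for values [f] subject to the
bounds that feasibility imposes on the gaps. *)
Lemma tensor_charge (I J K : finType) (p eps rho rx ry rz : R)
    (c : I -> J -> K -> bool) (X : {set I}) (Y : {set J}) (Z : {set K})
    (f : I -> J -> K -> R) (u : I -> R) (v : J -> R) (t : K -> R)
    (xo : I -> R) (yo : J -> R) (zo : K -> R) :
  0 <= p < 1 -> 0 <= eps <= rho / 2 -> regular p eps c ->
  rho = (1 - p) * (rx * ry * rz) -> 0 < rx -> 0 < ry -> 0 < rz ->
  (0 < #|I|)%N -> (0 < #|J|)%N -> (0 < #|K|)%N ->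
  #|X|%:R = rx * #|I|%:R -> #|Y|%:R = ry * #|J|%:R ->
  #|Z|%:R = rz * #|K|%:R ->
  (forall i, 0 <= u i) -> (forall j, 0 <= v j) -> (forall k, 0 <= t k) ->
  (forall i j k, ~~ c i j k -> 0 <= f i j k) ->
  (forall i j k, i \in X -> j \in Y -> k \in Z -> ~~ c i j k ->
     [/\ u i <= f i j k, v j <= f i j k & t k <= f i j k]) ->
  (forall i j k, i \in X -> j \in Y -> k \in Z -> c i j k ->
     f i j k <= u i + (v j + t k)) ->
  (forall i i' j k, i \in X -> i' \in X -> j \in Y -> k \in Z ->
     c i j k -> ~~ c i' j k -> f i j k <= u i + f i' j k) ->
  outer_bounds c (~: X) Y Z f v t xo ->
  outer_bounds (fun j k i => c i j k) (~: Y) Z X (fun j k i => f i j k) t u yo ->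
  outer_bounds (fun k i j => c i j k) (~: Z) X Y (fun k i j => f i j k) u v zo ->
  \sum_i \sum_j \sum_k (c i j k)%:R * f i j k <=
  (p * (1 + rx * ry * rz) / rho + 75 * eps / rho ^+ 3) *
  \sum_i \sum_j \sum_k (~~ c i j k)%:R * f i j k.
Proof.
move=> p01 /andP[e0 erho] cr rhoE rx0 ry0 rz0 I0 J0 K0 XE YE ZE u0 v0 t0 f0.
move=> fl fuvt fu oX oY oZ.
have /andP[p0 p1] := p01.
have [p1w q0] : p <= 1 /\ 0 < 1 - p by rewrite ltW// subr_gt0.
have p01w : 0 <= p <= 1 by rewrite p0.
have [rx1 ry1 rz1] : [/\ rx <= 1, ry <= 1 & rz <= 1].
  by split; [exact: ratio_le1 XE|exact: ratio_le1 YE|exact: ratio_le1 ZE].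
have [rx01 ry01 rz01] : [/\ 0 <= rx <= 1, 0 <= ry <= 1 & 0 <= rz <= 1].
  by rewrite (ltW rx0) (ltW ry0) (ltW rz0).
have rho0 : 0 < rho by rewrite rhoE !mulr_gt0.
have eps01 : 0 <= eps <= rho / 2 by rewrite e0.
have full (T : finType) : #|[set: T]|%:R = 1 * #|T|%:R :> R.
  by rewrite cardsT mul1r.
have compl (T : finType) (A : {set T}) (r : R) :
    #|A|%:R = r * #|T|%:R -> #|~: A|%:R = (1 - r) * #|T|%:R.
  rewrite mulrBl mul1r => <-; apply/eqP; rewrite eq_sym subr_eq addrC -natrD.
  by rewrite cardsC.
have rho_le (a b d : R) : 0 <= a -> 0 <= b -> d <= 1 ->
    rx * ry * rz = a * b * d -> 0 < rho <= (1 - p) * a * b.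
  move=> a0 b0 d1 E; rewrite rho0 rhoE E -[leRHS]mulrA.
  by rewrite ler_wpM2l ?(ltW q0)// ler_piMr// mulr_ge0.
have [rx0w [ry0w rz0w]] := (ltW rx0, (ltW ry0, ltW rz0)).
have rhoA : 0 < rho <= (1 - p) * ry * rz.
  by apply: (rho_le _ _ rx) => //; ring.
have rhoB : 0 < rho <= (1 - p) * rz * rx.
  by apply: (rho_le _ _ ry) => //; ring.
have rhoC : 0 < rho <= (1 - p) * rx * ry.
  by apply: (rho_le _ _ rz) => //; ring.
rewrite 2!(box_split X Y Z).
pose cY j k i := c i j k; pose fY j k i := f i j k.
pose cZ k i j := c i j k; pose fZ k i j := f i j k.
have crY : regular p eps cY := regular_rot cr.
have crZ : regular p eps cZ := regular_rot crY.
pose PU := #|J|%:R * #|K|%:R * \sum_(i in X) u i.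
pose PV := #|I|%:R * #|K|%:R * \sum_(j in Y) v j.
pose PT := #|I|%:R * #|J|%:R * \sum_(k in Z) t k.
have ncf0 i j k : 0 <= (~~ c i j k)%:R * f i j k.
  by case cijk: (c i j k); rewrite ?mul0r//= mul1r f0// cijk.
have P0 : [/\ 0 <= PU, 0 <= PV & 0 <= PT].
  by split; rewrite mulr_ge0 ?mulr_ge0 ?sumr_ge0.
have low1 (T1 T2 T3 : finType) (c' : T1 -> T2 -> T3 -> bool) (A1 : {set T1})
    (A2 : {set T2}) (A3 : {set T3}) (h : T1 -> R) (r2 r3 : R) :
    regular p eps c' -> #|A2|%:R = r2 * #|T2|%:R -> #|A3|%:R = r3 * #|T3|%:R ->
    (forall i, 0 <= h i) ->
    ((1 - p) * r2 * r3 - eps) * (#|T2|%:R * #|T3|%:R * \sum_(i in A1) h i) <=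
    \sum_(i in A1) \sum_(j in A2) \sum_(k in A3) (~~ c' i j k)%:R * h i.
  move=> cr' E2 E3 h0; apply: le_trans (slice_lower A1 A2 A3 cr' h0).
  by rewrite E2 E3 le_eqVlt; apply/orP; left; apply/eqP; ring.
have hu : ((1 - p) * ry * rz - eps) * PU <=
    \sum_(i in X) \sum_(j in Y) \sum_(k in Z) (~~ c i j k)%:R * u i.
  exact: low1 cr YE ZE u0.
have hv : ((1 - p) * rx * rz - eps) * PV <=
    \sum_(i in X) \sum_(j in Y) \sum_(k in Z) (~~ c i j k)%:R * v j.
  rewrite [(1 - p) * rx * rz]mulrAC /PV [#|I|%:R * _]mulrC box_rot.
  exact: low1 crY ZE XE v0.
have ht : ((1 - p) * rx * ry - eps) * PT <=
    \sum_(i in X) \sum_(j in Y) \sum_(k in Z) (~~ c i j k)%:R * t k.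
  by rewrite -box_rot; apply: low1 crZ XE YE t0.
apply: (charge_budget (PU := PU) (PV := PV) (PT := PT)) => //.
- by rewrite rx0.
- by rewrite ry0.
- by rewrite rz0.
- by split; do 3!(apply: sumr_ge0 => ? _).
- have := region_charge p01w eps01 cr J0 (full J) YE ZE (lexx 1) ry01 rz1 rhoA
    (finset.subsetT Y) (finset.subsetT Z) v0 t0 f0 oX.
  rewrite (compl _ _ _ XE) cardsT mulr1 -/PT; move=> h; apply: le_trans h _.
  by rewrite le_eqVlt; apply/orP; left; apply/eqP; rewrite /PV; ring.
- have := region_charge p01w eps01 crY K0 (full K) ZE XE (lexx 1) rz01 rx1 rhoB
    (finset.subsetT Z) (subxx X) t0 u0 (fun j k i => @f0 i j k) oY.
  rewrite (compl _ _ _ YE) XE mulr1; move=> h; apply: le_trans h _.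
  by rewrite le_eqVlt; apply/orP; left; apply/eqP; rewrite /PT /PU /fY; ring.
- have := region_charge p01w eps01 crZ I0 XE XE YE rx1 rx01 ry1 rhoC
    (subxx X) (subxx Y) u0 v0 (fun k i j => @f0 i j k) oZ.
  rewrite (compl _ _ _ ZE) YE; move=> h; apply: le_trans h _.
  rewrite le_eqVlt; apply/orP; left; apply/eqP; rewrite /PV /PU /fZ.
  by field; rewrite !gt_eqF.
- have := inside_charge p01 cr u0 v0 t0 f0 fuvt fu.
  rewrite YE ZE; move=> h; apply: le_trans h _.
  by rewrite le_eqVlt; apply/orP; left; apply/eqP; rewrite /PV /PU /PT; ring.
- apply: (@le_trans _ _ (\sum_(i in X) \sum_(j in Y) \sum_(k in Z)
    (rx * ry * ((~~ c i j k)%:R * u i) + (1 - rx) * ((~~ c i j k)%:R * v j) +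
     rx * (1 - ry) * ((~~ c i j k)%:R * t k)))).
    under eq_bigr do under eq_bigr do rewrite !big_split -!mulr_sumr.
    under eq_bigr do rewrite !big_split -!mulr_sumr.
    rewrite !big_split -!mulr_sumr; apply: lerD; first apply: lerD.
    - by apply: ler_wpM2l hu; rewrite mulr_ge0.
    - by apply: ler_wpM2l hv; rewrite subr_ge0.
    - by apply: ler_wpM2l ht; rewrite mulr_ge0// subr_ge0.
  apply: ler_sum => i iX; apply: ler_sum => j jY; apply: ler_sum => k kZ.
  case cijk: (c i j k); rewrite ?mul0r ?mul1r ?mulr0 ?addr0//=.
  have [|fu' fv' ft'] := fl i j k iX jY kZ; first by rewrite cijk.
  have rxry : 0 <= rx * ry by rewrite mulr_ge0.
  have rx' : 0 <= 1 - rx by rewrite subr_ge0.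
  have rxry' : 0 <= rx * (1 - ry) by rewrite mulr_ge0// subr_ge0.
  have := ler_wpM2l rxry fu'; have := ler_wpM2l rx' fv'.
  by have := ler_wpM2l rxry' ft'; lra.
- have half (a P S F : R) : rho <= a -> 0 <= P -> (a - eps) * P <= S -> S <= F ->
      rho / 2 * P <= F.
    move=> rhoa P0' aPS SF; apply: le_trans (le_trans aPS SF).
    by apply: ler_wpM2r => //; lra.
  have [PU0 PV0 PT0] := P0.
  have [[_ rhoA2] [_ rhoB2] [_ rhoC2]] :=
    And3 (andP rhoA) (andP rhoB) (andP rhoC).
  have leF (h : I -> J -> K -> R) :
      (forall i j k, i \in X -> j \in Y -> k \in Z -> ~~ c i j k ->
         h i j k <= f i j k) ->
      \sum_(i in X) \sum_(j in Y) \sum_(k in Z) (~~ c i j k)%:R * h i j k <=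
      \sum_(i in X) \sum_(j in Y) \sum_(k in Z) (~~ c i j k)%:R * f i j k.
    move=> hf.
    apply: ler_sum => i iX; apply: ler_sum => j jY; apply: ler_sum => k kZ.
    case cijk: (c i j k); rewrite ?mul0r ?mul1r//=.
    by apply: hf => //; rewrite cijk.
  split.
  + apply: half rhoA2 PU0 hu (leF (fun i _ _ => u i) _) => i j k iX jY kZ.
    by case/(fl i j k iX jY kZ).
  + apply: half PV0 hv (leF (fun _ j _ => v j) _); first by rewrite mulrAC.
    by move=> i j k iX jY kZ; case/(fl i j k iX jY kZ).
  + apply: half rhoC2 PT0 ht (leF (fun _ _ k => t k) _) => i j k iX jY kZ.
    by case/(fl i j k iX jY kZ).
Qed.

End Tensor.

(** * Recovery from a regular corruption pattern *)

Local Open Scope classical_set_scope.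
Local Open Scope ring_scope.

Section Recovery.
Variables (R : realType) (n m l : nat).
Variables (x : bvec n) (y : bvec m) (z : bvec l).
Implicit Types (g : btensor n m l) (s : lp_point R n m l) (e : entry n m l).

Lemma rank1E i j k : rank1 x y z (i, j, k) = [&& x i, y j & z k].
Proof. by rewrite ffunE. Qed.

Lemma ground_truth_feasible g : flp_feasible g (ground_truth R x y z).
Proof.
have b01 (b : bool) : 0 <= (b%:R : R) <= 1 by case: b; rewrite ?lexx ?ler01.
split => /=.
- move=> i j k _; rewrite !ffunE /=.
  by case: (x i); case: (y j); case: (z k); rewrite /= ?lexx ?ler01.
- move=> i j k _; rewrite !ffunE /=.
  by case: (x i); case: (y j); case: (z k); split => /=; lra.
- by split=> i j k a _ _; rewrite !ffunE /=; try case: (x a); try case: (y a);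
    try case: (z a); case: (x i); case: (y j); case: (z k) => /=; lra.
- by split=> a; rewrite ffunE.
Qed.

(** The distance of [w] from its intended value, signed so that at a
feasible point it is nonnegative wherever the input agrees with the ground truth: the objective
rewards lowering it there, and rewards raising it at the corrupted entries. *)
Definition gap s e : R := if rank1 x y z e then 1 - lp_w s e else lp_w s e.

Lemma flp_objective_gap g s :
  flp_objective g s - flp_objective g (ground_truth R x y z) =
  \sum_e (if g e == rank1 x y z e then gap s e else - gap s e).
Proof.
have obj s' : flp_objective g s' =
    \sum_e (if g e then 1 - lp_w s' e else lp_w s' e).
  rewrite /flp_objective [RHS](bigID (fun e => ~~ g e))/=.
  congr (_ + _); apply: eq_big => // e; rewrite ?negbK //.
    by move/negbTE->.
  by move->.
rewrite !obj -sumrB; apply: eq_bigr => e _; rewrite /gap /= [in LHS]ffunE.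
by case: (g e); case: (rank1 x y z e) => /=; ring.
Qed.

Lemma gap1 s i j k : x i -> y j -> z k -> gap s (i, j, k) = 1 - lp_w s (i, j, k).
Proof. by move=> xi yj zk; rewrite /gap rank1E xi yj zk. Qed.

Lemma gap0 s i j k : ~~ [&& x i, y j & z k] -> gap s (i, j, k) = lp_w s (i, j, k).
Proof. by move=> /negbTE ne; rewrite /gap rank1E ne. Qed.

Lemma lp_point_eq s1 s2 :
  lp_x s1 =1 lp_x s2 -> lp_y s1 =1 lp_y s2 -> lp_z s1 =1 lp_z s2 ->
  lp_w s1 =1 lp_w s2 -> s1 = s2.
Proof.
case: s1 s2 => [a1 b1 c1 d1] [a2 b2 c2 d2] /=.
by do 4 move/ffunP->.
Qed.

Lemma sum_entries (h : entry n m l -> R) :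
  \sum_e h e = \sum_i \sum_j \sum_k h (i, j, k).
Proof.
rewrite pair_bigA [RHS](pair_bigA _ (fun ij k => h (ij.1, ij.2, k)))/=.
by apply: eq_bigr => [[[i j] k]] _.
Qed.

Section Feasible.
Variables (g : btensor n m l) (s : lp_point R n m l) (C : {set entry n m l}).
Hypothesis feas : flp_feasible g s.
Hypothesis gC : corrupted (rank1 x y z) g \subset C.

Let u i : R := 1 - lp_x s i.
Let v j : R := 1 - lp_y s j.
Let t k : R := 1 - lp_z s k.

Lemma agree_off_C e : e \notin C -> g e = rank1 x y z e.
Proof.
move=> eC; apply/eqP; apply: contraNT eC => ge.
by apply: (fintype.subsetP gC); rewrite inE.
Qed.

Lemma gap_ge0 e : g e = rank1 x y z e -> 0 <= gap s e.
Proof.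
have [s1 s0 _ [x01 _ _]] := feas.
case: e => -[i j] k; rewrite rank1E; case xyz: [&& _, _ & _] => gE.
  have [wx _ _] := s1 i j k gE; case/and3P: xyz => xi yj zk.
  by rewrite gap1// subr_ge0 (le_trans wx)//; case/andP: (x01 i).
by rewrite gap0 ?xyz//; case: (s0 i j k); rewrite ?gE.
Qed.

(** Entries of [C] that the adversary has reverted carry no gain, so they are
given value 0; this makes the charging inequalities below hold on the whole
of [C], whatever the adversary did. *)
Definition live_gap e : R :=
  if (e \in C) && (g e == rank1 x y z e) then 0 else gap s e.

Let f i j k := live_gap (i, j, k).

Lemma live_gapN i j k : (i, j, k) \notin C -> f i j k = gap s (i, j, k).
Proof. by rewrite /f /live_gap => /negbTE->. Qed.

Lemma live_gap_ge0 i j k : (i, j, k) \notin C -> 0 <= f i j k.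
Proof. by move=> cn; rewrite live_gapN//; apply/gap_ge0/agree_off_C. Qed.

Lemma live_gap_le i j k B : (i, j, k) \in C -> 0 <= B ->
  (g (i, j, k) = ~~ rank1 x y z (i, j, k) -> gap s (i, j, k) <= B) ->
  f i j k <= B.
Proof.
rewrite /f /live_gap => -> B0 gB /=; case: eqP => // ne; apply: gB.
by case: (g _) (rank1 _ _ _ _) ne => [] [].
Qed.

Lemma inside_lower i j k : x i -> y j -> z k -> (i, j, k) \notin C ->
  [/\ u i <= f i j k, v j <= f i j k & t k <= f i j k].
Proof.
have [s1 _ _ _] := feas; move=> xi yj zk cn; rewrite live_gapN// gap1//.
have [] := s1 i j k; first by rewrite agree_off_C// rank1E xi yj zk.
by move=> wx wy wz; split; rewrite lerD2l lerN2.
Qed.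

Lemma inside_corner i j k : x i -> y j -> z k -> (i, j, k) \in C ->
  f i j k <= u i + (v j + t k).
Proof.
have [_ s0 _ [x01 y01 z01]] := feas; move=> xi yj zk cijk.
apply: live_gap_le => //.
  by apply: addr_ge0; last apply: addr_ge0; rewrite subr_ge0;
    [case/andP: (x01 i)|case/andP: (y01 j)|case/andP: (z01 k)].
rewrite gap1// rank1E xi yj zk => gE; have [] := s0 i j k; rewrite ?gE//.
by rewrite /u /v /t; lra.
Qed.

Lemma inside_flower i i' j k : x i -> x i' -> y j -> z k ->
  (i, j, k) \in C -> (i', j, k) \notin C -> f i j k <= u i + f i' j k.
Proof.
have [_ _ [fi _ _] [x01 _ _]] := feas; move=> xi xi' yj zk cijk cn.
apply: live_gap_le => //.
  by rewrite addr_ge0 ?live_gap_ge0// subr_ge0; case/andP: (x01 i).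
rewrite (live_gapN cn) !gap1// rank1E xi yj zk => gE; have := fi i j k i'.
rewrite gE agree_off_C// rank1E xi' yj zk => /(_ isT isT).
by rewrite /u; lra.
Qed.

Lemma outer_bounds_x :
  outer_bounds (fun i j k => (i, j, k) \in C) (~: [set i | x i])
    [set j | y j]%SET [set k | z k]%SET f v t (lp_x s).
Proof.
have [s1 s0 [_ fj _] [x01 y01 _]] := feas.
split=> [i|i j k|i j j' k|i j k]; rewrite ?inE.
- by case/andP: (x01 i).
- move=> xi cijk; apply: live_gap_le => //; first by case/andP: (x01 i).
  rewrite gap0; last by rewrite (negbTE xi).
  by rewrite rank1E (negbTE xi) => gE; case: (s1 i j k gE).
- move=> xi yj' cijk cn; apply: live_gap_le => //.
    by rewrite addr_ge0 ?live_gap_ge0// subr_ge0; case/andP: (y01 j').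
  rewrite (live_gapN cn) !gap0 ?rank1E (negbTE xi)//= => gE.
  have := fj i j' k j.
  rewrite gE agree_off_C// rank1E (negbTE xi) => /(_ isT isT).
  by rewrite /v; lra.
- move=> xi yj zk cn; rewrite live_gapN// gap0; last by rewrite (negbTE xi).
  have [] := s0 i j k; first by rewrite agree_off_C// rank1E (negbTE xi).
  by rewrite /v /t; lra.
Qed.

Lemma outer_bounds_y :
  outer_bounds (fun j k i => (i, j, k) \in C) (~: [set j | y j])
    [set k | z k]%SET [set i | x i]%SET (fun j k i => f i j k) t u (lp_y s).
Proof.
have [s1 s0 [_ _ fk] [_ y01 z01]] := feas.
split=> [j|j k i|j k k' i|j k i]; rewrite ?inE.
- by case/andP: (y01 j).
- move=> yj cijk; apply: live_gap_le => //; first by case/andP: (y01 j).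
  rewrite gap0; last by rewrite (negbTE yj) andbF.
  by rewrite rank1E (negbTE yj) andbF => gE; case: (s1 i j k gE).
- move=> yj zk' cijk cn; apply: live_gap_le => //.
    by rewrite addr_ge0 ?live_gap_ge0// subr_ge0; case/andP: (z01 k').
  rewrite (live_gapN cn) !gap0 ?rank1E (negbTE yj) ?andbF//= => gE.
  have := fk i j k' k.
  rewrite gE agree_off_C// rank1E (negbTE yj) andbF => /(_ isT isT).
  by rewrite /t; lra.
- move=> yj zk xi cn; rewrite live_gapN// gap0; last by rewrite (negbTE yj) andbF.
  have [] := s0 i j k; first by rewrite agree_off_C// rank1E (negbTE yj) andbF.
  by rewrite /u /t; lra.
Qed.

Lemma outer_bounds_z :
  outer_bounds (fun k i j => (i, j, k) \in C) (~: [set k | z k])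
    [set i | x i]%SET [set j | y j]%SET (fun k i j => f i j k) u v (lp_z s).
Proof.
have [s1 s0 [fi _ _] [x01 _ z01]] := feas.
split=> [k|k i j|k i i' j|k i j]; rewrite ?inE.
- by case/andP: (z01 k).
- move=> zk cijk; apply: live_gap_le => //; first by case/andP: (z01 k).
  rewrite gap0; last by rewrite (negbTE zk) !andbF.
  by rewrite rank1E (negbTE zk) !andbF => gE; case: (s1 i j k gE).
- move=> zk xi' cijk cn; apply: live_gap_le => //.
    by rewrite addr_ge0 ?live_gap_ge0// subr_ge0; case/andP: (x01 i').
  rewrite (live_gapN cn) !gap0 ?rank1E (negbTE zk) ?andbF//= => gE.
  have := fi i' j k i.
  rewrite gE agree_off_C// rank1E (negbTE zk) !andbF => /(_ isT isT).
  by rewrite /u; lra.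
- move=> zk xi yj cn; rewrite live_gapN// gap0; last first.
    by rewrite (negbTE zk) !andbF.
  have [] := s0 i j k; first by rewrite agree_off_C// rank1E (negbTE zk) !andbF.
  by rewrite /u /v; lra.
Qed.

Hypothesis sle : flp_objective g s <= flp_objective g (ground_truth R x y z).

Lemma gap_eq0_off_C (lambda : R) : lambda < 1 ->
  \sum_i \sum_j \sum_k ((i, j, k) \in C)%:R * f i j k <=
  lambda * \sum_i \sum_j \sum_k ((i, j, k) \notin C)%:R * f i j k ->
  forall e, e \notin C -> gap s e = 0.
Proof.
move=> lt1 charge.
pose Fn := \sum_i \sum_j \sum_k ((i, j, k) \notin C)%:R * f i j k.
have Fn0 : Fn <= 0.
  have objle : Fn - \sum_i \sum_j \sum_k ((i, j, k) \in C)%:R * f i j k <=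
      flp_objective g s - flp_objective g (ground_truth R x y z).
    rewrite flp_objective_gap sum_entries -sumrB; apply: ler_sum => i _.
    rewrite -sumrB; apply: ler_sum => j _.
    rewrite -sumrB; apply: ler_sum => k _; rewrite /f /live_gap.
    case cijk: (_ \in C); rewrite /= ?mul0r ?mul1r ?subr0 ?sub0r; last first.
      by rewrite agree_off_C ?cijk// eqxx.
    by case: eqP => [/gap_ge0|_]; rewrite ?oppr0.
  have lt := lt1; rewrite -subr_gt0 in lt.
  rewrite -(pmulr_rle0 _ lt); move: charge objle sle; rewrite -/Fn; lra.
have ncf0 i j k : 0 <= ((i, j, k) \notin C)%:R * f i j k.
  by case cijk: (_ \in C); rewrite ?mul0r//= mul1r live_gap_ge0// cijk.
case=> -[i j] k cn; rewrite -live_gapN//.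
apply/eqP; rewrite eq_le live_gap_ge0// andbT.
apply: le_trans Fn0; rewrite /Fn (bigD1 i)//= (bigD1 j)//= (bigD1 k)//= cn.
rewrite mul1r -!addrA lerDl.
by apply: addr_ge0; last apply: addr_ge0; do !(apply: sumr_ge0 => * ).
Qed.

(** Once the gaps vanish off [C], one uncorrupted entry in each slice forces
its coordinate to the right value: the bound [w <= x] if that coordinate is
in the support, and [x + y + z - 2 <= w] otherwise. All signed gaps are then
nonnegative, and their sum is nonpositive. *)
Lemma ground_truth_of_gap :
  (forall e, e \notin C -> gap s e = 0) ->
  (forall i, exists j k, [/\ y j, z k & (i, j, k) \notin C]) ->
  (forall j, exists i k, [/\ x i, z k & (i, j, k) \notin C]) ->
  (forall k, exists i j, [/\ x i, y j & (i, j, k) \notin C]) ->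
  s = ground_truth R x y z.
Proof.
move=> fz clear_i clear_j clear_k.
have [s1 s0 _ [x01 y01 z01]] := feas.
have tight i j k : x i -> y j -> z k -> (i, j, k) \notin C ->
    [/\ lp_x s i = 1, lp_y s j = 1 & lp_z s k = 1].
  move=> xi yj zk cn; have := fz _ cn; rewrite gap1// => w1.
  have [] := s1 i j k; first by rewrite agree_off_C// rank1E xi yj zk.
  case/andP: (x01 i) (y01 j) (z01 k) => _ + /andP[_ +] /andP[_ +].
  by split; lra.
have loose i j k : ~~ [&& x i, y j & z k] -> (i, j, k) \notin C ->
    lp_x s i + lp_y s j + lp_z s k <= 2.
  move=> ne cn; have := fz _ cn; rewrite gap0// => w0.
  have [|_] := s0 i j k; first by rewrite agree_off_C// rank1E (negbTE ne).
  by lra.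
have x1 i : x i -> lp_x s i = 1.
  by move=> xi; have [j [k [yj zk /(tight _ _ _ xi yj zk)[]]]] := clear_i i.
have y1 j : y j -> lp_y s j = 1.
  by move=> yj; have [i [k [xi zk /(tight _ _ _ xi yj zk)[]]]] := clear_j j.
have z1 k : z k -> lp_z s k = 1.
  by move=> zk; have [i [j [xi yj /(tight _ _ _ xi yj zk)[]]]] := clear_k k.
have xE i : lp_x s i = (x i)%:R.
  case xi: (x i); first exact: x1.
  rewrite [RHS](_ : _ = 0)//; have [j [k [yj zk /loose]]] := clear_i i.
  by rewrite xi y1// z1// => /(_ isT); case/andP: (x01 i); lra.
have yE j : lp_y s j = (y j)%:R.
  case yj: (y j); first exact: y1.
  rewrite [RHS](_ : _ = 0)//; have [i [k [xi zk /loose]]] := clear_j j.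
  by rewrite yj andbF x1// z1// => /(_ isT); case/andP: (y01 j); lra.
have zE k : lp_z s k = (z k)%:R.
  case zk: (z k); first exact: z1.
  rewrite [RHS](_ : _ = 0)//; have [i [j [xi yj /loose]]] := clear_k k.
  by rewrite zk !andbF x1// y1// => /(_ isT); case/andP: (z01 k); lra.
have sgn_ge0 e : 0 <= if g e == rank1 x y z e then gap s e else - gap s e.
  case: e => [[i j] k]; case: eqP => [|/eqP ne]; first exact: gap_ge0.
  rewrite oppr_ge0; case xyz: [&& x i, y j & z k]; last first.
    rewrite gap0 ?xyz//.
    have gE : g (i, j, k) by move: ne; rewrite rank1E xyz; case: (g _).
    have [] := s1 i j k gE; rewrite xE yE zE.
    by move: xyz; case: (x i); case: (y j); case: (z k).
  case/and3P: xyz => xi yj zk; rewrite gap1//.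
  have gE : ~~ g (i, j, k) by move: ne; rewrite rank1E xi yj zk; case: (g _).
  by have [] := s0 i j k gE; rewrite x1// y1// z1//; lra.
have sumz : \sum_e (if g e == rank1 x y z e then gap s e else - gap s e) = 0.
  apply/eqP; rewrite eq_le sumr_ge0// andbT -flp_objective_gap subr_le0.
  exact: sle.
have gapz e : gap s e = 0.
  have /eqP := sumz; rewrite psumr_eq0// => /allP /(_ e (mem_index_enum e)) /=.
  by case: ifP => _ /eqP => [//|/eqP]; rewrite oppr_eq0 => /eqP.
have wE e : lp_w s e = (rank1 x y z e)%:R.
  have := gapz e; rewrite /gap; case: (rank1 x y z e) => // /eqP.
  by rewrite subr_eq0 => /eqP <-.
by apply: lp_point_eq => a; rewrite [RHS]ffunE.
Qed.

End Feasible.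

(** The deterministic half of the theorem, in terms of the set [C] of entries
corrupted at random; the adversary only enters through the inclusion. *)
Lemma regular_recovers g (C : {set entry n m l}) (p eps rho rx ry rz : R) :
  0 <= p < 1 -> 0 <= eps <= rho / 2 ->
  rho = (1 - p) * (rx * ry * rz) -> 0 < rx -> 0 < ry -> 0 < rz ->
  (0 < n)%N -> (0 < m)%N -> (0 < l)%N ->
  ones_ratio R x = rx -> ones_ratio R y = ry -> ones_ratio R z = rz ->
  p * (1 + rx * ry * rz) / rho + 75 * eps / rho ^+ 3 < 1 ->
  regular p eps (fun i j k => (i, j, k) \in C) ->
  corrupted (rank1 x y z) g \subset C ->
  flp_recovers R x y z g.
Proof.
move=> p01 e01 rhoE rx0 ry0 rz0 n0 m0 l0 xr yr zr small cr gC.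
have card_ones (a : nat) (b : bvec a) (r : R) : (0 < a)%N ->
    ones_ratio R b = r -> #|[set i | b i]%SET|%:R = r * #|'I_a|%:R.
  by move=> a0 <-; rewrite card_ord /ones_ratio mulfVK// pnatr_eq0 -lt0n.
have XE := card_ones _ _ _ n0 xr.
have YE := card_ones _ _ _ m0 yr.
have ZE := card_ones _ _ _ l0 zr.
have I0 : (0 < #|'I_n|)%N by rewrite card_ord.
have J0 : (0 < #|'I_m|)%N by rewrite card_ord.
have K0 : (0 < #|'I_l|)%N by rewrite card_ord.
have [rx1 ry1 rz1] : [/\ rx <= 1, ry <= 1 & rz <= 1].
  by split; [exact: ratio_le1 XE|exact: ratio_le1 YE|exact: ratio_le1 ZE].
have /andP[_ p1] := p01.
have eps_rho : eps < rho.
  have rho0 : 0 < rho by rewrite rhoE !mulr_gt0// subr_gt0.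
  by case/andP: e01 rho0; lra.
have thick (a b q : R) (T1 T2 : finType) (A : {set T1}) (B : {set T2}) :
    (0 < #|T1|)%N -> (0 < #|T2|)%N -> #|A|%:R = a * #|T1|%:R ->
    #|B|%:R = b * #|T2|%:R -> q <= 1 -> 0 < a -> 0 < b ->
    rx * ry * rz = q * (a * b) ->
    eps * #|T1|%:R * #|T2|%:R < (1 - p) * #|A|%:R * #|B|%:R.
  move=> T10 T20 -> -> q1 a0 b0 rE.
  have -> : (1 - p) * (a * #|T1|%:R) * (b * #|T2|%:R) =
    (1 - p) * (a * b) * #|T1|%:R * #|T2|%:R by ring.
  rewrite !ltr_pM2r ?ltr0n//; apply: lt_le_trans eps_rho _.
  by rewrite rhoE rE ler_wpM2l ?subr_ge0 ?(ltW p1)// ler_piMl// mulr_ge0// ltW.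
have [ci cj ck] := cr.
have clear_i i : exists j k, [/\ y j, z k & (i, j, k) \notin C].
  have [|j [k []]] := exists_uncorrupted (A := [set j | y j]%SET)
      (B := [set k | z k]%SET) (ci i).
    by apply: (thick ry rz rx) => //; ring.
  by rewrite !inE => yj zk cn; exists j, k.
have clear_j j : exists i k, [/\ x i, z k & (i, j, k) \notin C].
  have [|i [k []]] := exists_uncorrupted (A := [set i | x i]%SET)
      (B := [set k | z k]%SET) (cj j).
    by apply: (thick rx rz ry) => //; ring.
  by rewrite !inE => xi zk cn; exists i, k.
have clear_k k : exists i j, [/\ x i, y j & (i, j, k) \notin C].
  have [|i [j []]] := exists_uncorrupted (A := [set i | x i]%SET)
      (B := [set j | y j]%SET) (ck k).
    by apply: (thick rx ry rz) => //; ring.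
  by rewrite !inE => xi yj cn; exists i, j.
have uniq s : flp_feasible g s ->
    flp_objective g s <= flp_objective g (ground_truth R x y z) ->
    s = ground_truth R x y z.
  move=> feas sle; apply: (ground_truth_of_gap feas gC sle) => //.
  apply: (gap_eq0_off_C feas gC sle small).
  have [_ _ _ [x01 y01 z01]] := feas.
  apply: (tensor_charge p01 e01 cr rhoE rx0 ry0 rz0 I0 J0 K0 XE YE ZE
    (u := fun i => 1 - lp_x s i) (v := fun j => 1 - lp_y s j)
    (t := fun k => 1 - lp_z s k)).
  - by move=> i; rewrite subr_ge0; case/andP: (x01 i).
  - by move=> j; rewrite subr_ge0; case/andP: (y01 j).
  - by move=> k; rewrite subr_ge0; case/andP: (z01 k).
  - by move=> i j k; exact: live_gap_ge0.
  - by move=> i j k; rewrite !inE; exact: inside_lower.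
  - by move=> i j k; rewrite !inE; exact: inside_corner.
  - by move=> i i' j k; rewrite !inE; exact: inside_flower.
  - exact: outer_bounds_x.
  - exact: outer_bounds_y.
  - exact: outer_bounds_z.
move=> s; split=> [[feas opt]|->].
  by apply: uniq => //; apply: opt; exact: ground_truth_feasible.
split=> [|s' feas]; first exact: ground_truth_feasible.
rewrite leNgt; apply/negP => lt; move: (lt).
by rewrite (uniq s' feas (ltW lt)) ltxx.
Qed.

End Recovery.

(** * Regularity of independent noise *)

Section NoiseTail.
Variables (R : realType) (n m l : nat) (W : btensor n m l) (p : R).
Hypothesis p01 : 0 <= p <= 1.
Implicit Types (g : btensor n m l) (E : btensor n m l -> Prop).

Lemma noise_pmf_ge0 g : 0 <= noise_pmf W p g.
Proof.
by apply: prodr_ge0 => e _; case: ifP; rewrite ?subr_ge0; case/andP: p01.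
Qed.

Lemma noise_pmf_expect_prod (F : entry n m l -> bool -> R) :
  \sum_g noise_pmf W p g * \prod_e F e (g e == W e) =
  \prod_e ((1 - p) * F e true + p * F e false).
Proof.
transitivity (\prod_e \sum_(b : bool)
    (if b == W e then 1 - p else p) * F e (b == W e)).
  rewrite bigA_distr_bigA; apply: eq_bigr => g _.
  by rewrite /noise_pmf -big_split.
apply: eq_bigr => e _; rewrite big_bool.
by case: (W e); rewrite //= addrC.
Qed.

Lemma noise_pmf_total : \sum_g noise_pmf W p g = 1.
Proof.
have := noise_pmf_expect_prod (fun _ _ => 1).
rewrite [RHS]big1 => [<-|e _]; last by rewrite !mulr1 subrK.
by apply: eq_bigr => g _; rewrite big1 ?mulr1.
Qed.

Lemma noise_prob_markov E (h : btensor n m l -> R) :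
  (forall g, 0 <= h g) -> (forall g, E g -> 1 <= h g) ->
  noise_prob W p E <= \sum_g noise_pmf W p g * h g.
Proof.
move=> h0 h1; rewrite /noise_prob big_mkcond; apply: ler_sum => g _.
case: asboolP => [/h1|_]; last by rewrite mulr_ge0// noise_pmf_ge0.
by move=> h1g; rewrite ler_peMr// noise_pmf_ge0.
Qed.

Lemma noise_prob_le E1 E2 :
  (forall g, E1 g -> E2 g) -> noise_prob W p E1 <= noise_prob W p E2.
Proof.
move=> E12; rewrite [leRHS]/noise_prob big_mkcond.
apply: le_trans (noise_prob_markov (E := E1) (h := fun g => `[<E2 g>]%:R) _ _) _.
- by move=> g; rewrite ler0n.
- by move=> g /E12/asboolP ->.
- by apply: ler_sum => g _; case: ifP; rewrite ?mulr1 ?mulr0.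
Qed.

Lemma noise_prob_exists (T : finType) (E : T -> btensor n m l -> Prop) :
  noise_prob W p (fun g => exists a, E a g) <= \sum_a noise_prob W p (E a).
Proof.
have -> : \sum_a noise_prob W p (E a) =
    \sum_g noise_pmf W p g * \sum_a `[<E a g>]%:R.
  under [RHS]eq_bigr do rewrite mulr_sumr.
  rewrite [RHS]exchange_big; apply: eq_bigr => a _.
  rewrite /noise_prob big_mkcond; apply: eq_bigr => g _.
  by case: ifP; rewrite ?mulr1 ?mulr0.
apply: noise_prob_markov => [g|g [a Ea]]; first exact: sumr_ge0.
by rewrite (bigD1 a)//= (asboolT Ea) lerDl sumr_ge0.
Qed.

Lemma noise_prob_or E1 E2 :
  noise_prob W p (fun g => E1 g \/ E2 g) <=
  noise_prob W p E1 + noise_prob W p E2.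
Proof.
have := noise_prob_exists (fun b : bool => if b then E1 else E2).
rewrite big_bool; apply: le_trans; apply: noise_prob_le => g.
by case=> ?; [exists true|exists false].
Qed.

Lemma noise_prob_compl E :
  1 - noise_prob W p (fun g => ~ E g) <= noise_prob W p E <= 1.
Proof.
apply/andP; split.
  rewrite lerBlDr -noise_pmf_total.
  apply: le_trans _ (noise_prob_or E (fun g => ~ E g)).
  rewrite /noise_prob [leRHS]big_mkcond; apply: ler_sum => g _.
  by rewrite (asboolT (EM (E g))).
apply: le_trans (noise_prob_markov (h := fun _ => 1) _ _) _ => //.
by under eq_bigr do rewrite mulr1; rewrite noise_pmf_total.
Qed.

Lemma expR_le_quad (th : R) :
  0 <= th <= 1 / 2 -> expR th <= 1 + th + 2 * th ^+ 2.
Proof.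
move=> /andP[th0 th1].
have lo : 0 < 1 - th by lra.
have : expR th * (1 - th) <= 1.
  by rewrite -ler_pdivlMl ?expR_gt0// mulr1 -expRN; exact: expR_ge1Dx.
move=> /le_trans h; rewrite -(ler_pM2r lo); apply: h; nra.
Qed.

(** Chernoff bound for the number of corrupted ([b = false]) or uncorrupted
([b = true]) entries of [S]. The deviation is measured against a number [M]
that may exceed the size of [S], so that all rectangles of a plane are
treated uniformly. *)
Lemma noise_tail (S : {set entry n m l}) (b : bool) (eps M : R) :
  let q := if b then 1 - p else p in
  0 <= eps <= 2 -> #|S|%:R <= M ->
  noise_prob W p (fun g =>
    q * #|S|%:R + eps * M < \sum_(e in S) ((g e == W e) == b)%:R)
  <= expR (- (eps ^+ 2 / 8 * M)).
Proof.
move=> q /andP[e0 e2] SM.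
have M0 : 0 <= M := le_trans (ler0n _ _) SM.
have q01 : 0 <= q <= 1.
  by rewrite /q; case: (b); case/andP: p01 => *; apply/andP; split; lra.
(* minimizes the exponent [2 th^2 - th eps] *)
pose th := eps / 4.
have th0 : 0 <= th by rewrite /th; lra.
have thle : 0 <= th <= 1 / 2 by rewrite th0 /th; lra.
pose F e (a : bool) := if e \in S then expR (th * (a == b)%:R) else 1.
pose K := expR (- (th * (q * #|S|%:R + eps * M))).
have hE g : K * \prod_e F e (g e == W e) =
    expR (th * (\sum_(e in S) ((g e == W e) == b)%:R -
                (q * #|S|%:R + eps * M))).
  rewrite mulrBr expRD mulrC; congr (_ * _).
  rewrite mulr_sumr expR_sum [RHS]big_mkcond.
  by apply: eq_bigr.
apply: le_trans (noise_prob_markov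
  (h := fun g => K * \prod_e F e (g e == W e)) _ _) _.
- by move=> g; rewrite hE expR_ge0.
- move=> g lt; rewrite hE -[leLHS]expR0 ler_expR mulr_ge0// subr_ge0; exact: ltW.
under eq_bigr do rewrite /= mulrCA.
rewrite -mulr_sumr noise_pmf_expect_prod.
have step : \prod_e ((1 - p) * F e true + p * F e false) <=
    \prod_(e in S) expR (q * (th + 2 * th ^+ 2)).
  rewrite [leRHS]big_mkcond; apply: ler_prod => e _.
  have -> : (1 - p) * F e true + p * F e false =
      if e \in S then 1 + q * (expR th - 1) else 1.
    rewrite /F /q; case: ifP => _; last by ring.
    by case: (b); rewrite /= mulr0 mulr1 expR0; ring.
  case: ifP => _; last by rewrite lexx ler01.
  have ex1 : 1 <= expR th by rewrite -[leLHS]expR0 ler_expR.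
  case/andP: q01 => q0 _; apply/andP; split.
    by rewrite addr_ge0// mulr_ge0// subr_ge0.
  apply: le_trans (expR_ge1Dx _); rewrite lerD2l ler_wpM2l//.
  by have := expR_le_quad thle; lra.
apply: le_trans (ler_wpM2l (expR_ge0 _) step) _.
rewrite -expR_sum sumr_const -expRD ler_expR -[_ *+ _]mulr_natr.
have qS : q * #|S|%:R <= M.
  by apply: le_trans SM; rewrite ler_piMl//; case/andP: q01.
have thE : eps = 4 * th by rewrite /th; field.
rewrite thE.
have := ler_wpM2l (mulr_ge0 (ler0n R 2) (mulr_ge0 th0 th0)) qS.
by rewrite !expr2; lra.
Qed.

(** Union bound over the [2 ^ (|J| + |K|)] rectangles and the two directions of
deviation. *)
Lemma noise_unbalanced (J K : finType) (phi : J -> K -> entry n m l) (eps : R) :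
  injective (fun jk : J * K => phi jk.1 jk.2) -> 0 <= eps <= 2 ->
  noise_prob W p (fun g =>
    ~ balanced p eps (fun j k => phi j k \in corrupted W g)) <=
  2 ^+ (#|J| + #|K|).+1 * expR (- (eps ^+ 2 / 8 * (#|J|%:R * #|K|%:R))).
Proof.
move=> phi_inj e02.
pose T := ({set J} * {set K} * bool)%type.
pose S (a : T) := [set phi jk.1 jk.2 | jk in finset.setX a.1.1 a.1.2]%SET.
have cardS a : #|S a|%:R = #|a.1.1|%:R * #|a.1.2|%:R :> R.
  by rewrite card_imset// cardsX natrM.
pose q (a : T) := if a.2 then 1 - p else p.
pose M : R := #|J|%:R * #|K|%:R.
have SM a : #|S a|%:R <= M.
  by rewrite cardS ler_pM// ler_nat max_card.
pose E (a : T) g :=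
  q a * #|S a|%:R + eps * M < \sum_(e in S a) ((g e == W e) == a.2)%:R.
have sumS a (h : entry n m l -> R) :
    \sum_(e in S a) h e = \sum_(j in a.1.1) \sum_(k in a.1.2) h (phi j k).
  rewrite big_imset/=; last by move=> ? ? _ _; exact: phi_inj.
  by rewrite pair_big; apply: eq_bigl => -[j k]; rewrite finset.in_setX.
apply: (@le_trans _ _ (noise_prob W p (fun g => exists a, E a g))).
  apply: noise_prob_le => g nb; apply: contrapT => noE; apply: nb => A B.
  have bound b : \sum_(j in A) \sum_(k in B)
      ((g (phi j k) == W (phi j k)) == b)%:R <=
      (if b then 1 - p else p) * (#|A|%:R * #|B|%:R) + eps * M.
    rewrite leNgt; apply/negP => lt; apply: noE; exists (A, B, b).
    by rewrite /E cardS sumS.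
  have cE : \sum_(j in A) \sum_(k in B) ((phi j k \in corrupted W g)%:R - p) =
      \sum_(j in A) \sum_(k in B) ((g (phi j k) == W (phi j k)) == false)%:R -
      p * (#|A|%:R * #|B|%:R).
    under eq_bigr do rewrite sumrB sumr_const.
    rewrite sumrB sumr_const -mulrnA -[p *+ _]mulr_natr natrM.
    rewrite [#|B|%:R * _]mulrC; congr (_ - _).
    by apply: eq_bigr => j _; apply: eq_bigr => k _; rewrite inE eqbF_neg.
  have cE' : \sum_(j in A) \sum_(k in B) ((phi j k \in corrupted W g)%:R - p) =
      (1 - p) * (#|A|%:R * #|B|%:R) -
      \sum_(j in A) \sum_(k in B) ((g (phi j k) == W (phi j k)) == true)%:R.
    rewrite -natrM -cardsX mulr_natr.
    have -> : (1 - p) *+ #|finset.setX A B| =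
      \sum_(j in A) \sum_(k in B) (1 - p).
      by rewrite !sumr_const -mulrnA cardsX mulnC.
    rewrite -sumrB; apply: eq_bigr => j _; rewrite -sumrB.
    apply: eq_bigr => k _; rewrite inE eqb_id.
    by case: (g _ == _) => /=; ring.
  rewrite -mulrA -/M ler_norml; apply/andP; split.
    by rewrite cE'; have := bound true; lra.
  by rewrite cE; have := bound false; lra.
apply: le_trans (noise_prob_exists E) _.
apply: (@le_trans _ _ (\sum_(a : T) expR (- (eps ^+ 2 / 8 * M)))).
  by apply: ler_sum => a _; exact: noise_tail.
rewrite sumr_const -[_ *+ _]mulr_natl -natrX ler_wpM2r ?expR_ge0// ler_nat.
have card_sets (U : finType) : #|{set U}| = (2 ^ #|U|)%N.
  by rewrite -[in RHS]cardsT -card_powerset powersetT cardsT.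
by rewrite !card_prod card_bool !card_sets -expnD -expnSr.
Qed.

(** The union bound for [a] parallel planes of size [b * c]. *)
Definition plane_tail (a b c : nat) (eps : R) : R :=
  a%:R * (2 ^+ (b + c).+1 * expR (- (eps ^+ 2 / 8 * (b%:R * c%:R)))).

Lemma noise_irregular (eps : R) : 0 <= eps <= 2 ->
  noise_prob W p (fun g =>
    ~ regular p eps (fun i j k => (i, j, k) \in corrupted W g)) <=
  plane_tail n m l eps + plane_tail m n l eps + plane_tail l n m eps.
Proof.
move=> e02.
pose c g i j k := (i, j, k) \in corrupted W g.
apply: (@le_trans _ _ (noise_prob W p (fun g =>
  ((exists i, ~ balanced p eps (c g i)) \/
   (exists j, ~ balanced p eps (fun i k => c g i j k))) \/
  (exists k, ~ balanced p eps (fun i j => c g i j k))))).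
  apply: noise_prob_le => g nr; apply: contrapT => ne; apply: nr.
  by split=> a; apply: contrapT => nb; apply: ne;
    [left; left|left; right|right]; exists a.
have plane (T J K : finType) (phi : T -> J -> K -> entry n m l) :
    (forall a, injective (fun jk : J * K => phi a jk.1 jk.2)) ->
    noise_prob W p (fun g => exists a,
      ~ balanced p eps (fun j k => phi a j k \in corrupted W g)) <=
    plane_tail #|T| #|J| #|K| eps.
  move=> phi_inj; apply: le_trans (noise_prob_exists _) _.
  rewrite /plane_tail mulr_natl -sumr_const.
  by apply: ler_sum => a _; exact: noise_unbalanced.
have -> : plane_tail n m l eps = plane_tail #|'I_n| #|'I_m| #|'I_l| eps.
  by rewrite !card_ord.
have -> : plane_tail m n l eps = plane_tail #|'I_m| #|'I_n| #|'I_l| eps.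
  by rewrite !card_ord.
have -> : plane_tail l n m eps = plane_tail #|'I_l| #|'I_n| #|'I_m| eps.
  by rewrite !card_ord.
apply: le_trans (noise_prob_or _ _) _; apply: lerD.
  apply: le_trans (noise_prob_or _ _) _; apply: lerD.
    by apply: (plane _ _ _ (fun i j k => (i, j, k))) => a [j k] [j' k'] [-> ->].
  by apply: (plane _ _ _ (fun j i k => (i, j, k))) => a [j k] [j' k'] [-> ->].
by apply: (plane _ _ _ (fun k i j => (i, j, k))) => a [j k] [j' k'] [-> ->].
Qed.

End NoiseTail.

(** * Asymptotics *)

Section Asymptotics.
Variable R : realType.

(** The growth assumption makes the number [a] of planes at most [exp b]; the
decay [exp (- kappa b c)] beats this and the [2 ^ (b + c)] rectangles as soon as
[b] and [c] exceed a constant. *)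
Lemma plane_tail_le (a b c : nat) (eps : R) :
  let kappa := eps ^+ 2 / 8 in
  (0 < a)%N -> (0 < b)%N -> (0 < c)%N ->
  4 <= kappa * b%:R -> 8 <= kappa * c%:R ->
  (a * b * c)%:R * expR (- b%:R) <= 1 :> R ->
  plane_tail a b c eps <= (a * b * c)%:R * expR (- b%:R).
Proof.
move=> kappa a0 b0 c0 kb kc growth.
have abc_le : (a * b * c)%:R <= expR b%:R :> R.
  by rewrite -[leRHS]mul1r -ler_pdivrMr ?expR_gt0// -expRN.
have a_le : a%:R <= expR b%:R :> R.
  apply: le_trans abc_le; rewrite ler_nat -mulnA leq_pmulr// muln_gt0 b0.
  exact: c0.
have two_le : 2 <= expR 1 :> R.
  by apply: le_trans (expR_ge1Dx _); rewrite -natr1.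
have pow_le : 2 ^+ (b + c).+1 <= expR (b%:R + c%:R + 1) :> R.
  have -> : b%:R + c%:R + 1 = (b + c).+1%:R * 1 :> R.
    by rewrite mulr1 -natr1 natrD.
  by rewrite expRM_natl lerXn2r// nnegrE// expR_ge0.
apply: (@le_trans _ _ (expR (- b%:R))); last first.
  by rewrite ler_peMl ?expR_ge0// ler1n !muln_gt0 a0 b0 c0.
apply: (@le_trans _ _ (expR b%:R * (expR (b%:R + c%:R + 1) *
    expR (- (kappa * (b%:R * c%:R)))))).
  rewrite ler_pM// ?mulr_ge0 ?exprn_ge0 ?expR_ge0//.
  by rewrite ler_wpM2r ?expR_ge0.
rewrite -!expRD ler_expR.
have b1 : 1 <= b%:R :> R by rewrite ler1n.
have c1 : 1 <= c%:R :> R by rewrite ler1n.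
have h1 : 4 * c%:R <= kappa * b%:R * c%:R by apply: ler_wpM2r.
have h2 : 8 * b%:R <= kappa * c%:R * b%:R by apply: ler_wpM2r.
lra.
Qed.

Lemma near_large (u : nat -> nat) (kappa B : R) : 0 < kappa ->
  u @ \oo --> \oo -> \forall t \near \oo, B <= kappa * (u t)%:R.
Proof.
move=> k0 /cvgnyPge /(_ (Num.truncn `|B / kappa|).+1).
apply: filterS => t Bt; rewrite mulrC -ler_pdivrMr//.
apply: le_trans (ler_norm _) _; apply: ltW.
apply: lt_le_trans (truncnS_gt _) _; by rewrite ler_nat.
Qed.

Lemma ratio_dim_gt0 (n : nat) (b : bvec n) (r : R) :
  0 < r -> ones_ratio R b = r -> (0 < n)%N.
Proof.
case: n b => // b r0; rewrite /ones_ratio invr0 mulr0 => r0'.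
by rewrite -r0' ltxx in r0.
Qed.

Lemma corrupted_revert (n m l : nat) (W : btensor n m l) D (g : btensor n m l) :
  corrupted W (revert W D g) \subset corrupted W g.
Proof.
by apply/fintype.subsetP => e; rewrite !inE ffunE; case: ifP => _; rewrite ?eqxx.
Qed.

(** The threshold on [p] is exactly what makes the total charging rate less
than 1. *)
Lemma threshold_slack (r p : R) : 0 < r -> 0 <= p -> p < r / (1 + 2 * r) ->
  p < 1 /\ p * (1 + r) / ((1 - p) * r) < 1.
Proof.
move=> r0 p0; rewrite ltr_pdivlMr; last by lra.
move=> plt.
have pr : 0 <= p * r by rewrite mulr_ge0// ltW.
have p1 : p < 1.
  rewrite -(ltr_pM2r r0) mul1r; lra.
by split=> //; rewrite ltr_pdivrMr ?mulr_gt0 ?subr_gt0//; lra.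
Qed.

End Asymptotics.

Theorem theorem4 (R : realType) (rx ry rz p : R) (n m l : nat -> nat)
  (x : forall t, bvec (n t)) (y : forall t, bvec (m t))
  (z : forall t, bvec (l t))
  (A : forall t, btensor (n t) (m t) (l t) ->
         {set entry (n t) (m t) (l t)})
  (rx_gt0 : 0 < rx) (ry_gt0 : 0 < ry) (rz_gt0 : 0 < rz)
  (x_ratio : forall t, ones_ratio R (x t) = rx)
  (y_ratio : forall t, ones_ratio R (y t) = ry)
  (z_ratio : forall t, ones_ratio R (z t) = rz)
  (A_monotone : forall t, monotone_adversary (rank1 (x t) (y t) (z t)) (@A t))
  (n_infty : n @ \oo --> \oo) (m_infty : m @ \oo --> \oo)
  (l_infty : l @ \oo --> \oo)
  (n_growth : (fun t => (n t * m t * l t)%:R * expR (- (n t)%:R)) @ \oo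
                --> (0 : R))
  (m_growth : (fun t => (n t * m t * l t)%:R * expR (- (m t)%:R)) @ \oo
                --> (0 : R))
  (l_growth : (fun t => (n t * m t * l t)%:R * expR (- (l t)%:R)) @ \oo
                --> (0 : R))
  (p_prob : 0 <= p <= 1)
  (p_lt : let rw := rx * ry * rz in p < rw / (1 + 2 * rw)) :
  (fun t =>
     noise_prob (rank1 (x t) (y t) (z t)) p (fun g =>
       flp_recovers R (x t) (y t) (z t)
         (adversarial_input (rank1 (x t) (y t) (z t)) (@A t) g)))
    @ \oo --> (1 : R).
Proof.
have [p0 _] := andP p_prob.
set r := rx * ry * rz in p_lt.
have r0 : 0 < r by rewrite !mulr_gt0.
have [p1 mu1] := threshold_slack r0 p0 p_lt.
pose rho := (1 - p) * r.
pose mu := p * (1 + r) / rho.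
(* makes the error term of [tensor_charge] half of the slack [1 - mu] *)
pose eps := rho ^+ 3 * (1 - mu) / 150.
rewrite -/rho -/mu in mu1.
have q0 : 0 < 1 - p by rewrite subr_gt0.
have rho0 : 0 < rho by rewrite mulr_gt0.
have n0 t : (0 < n t)%N := ratio_dim_gt0 rx_gt0 (x_ratio t).
have m0 t : (0 < m t)%N := ratio_dim_gt0 ry_gt0 (y_ratio t).
have l0 t : (0 < l t)%N := ratio_dim_gt0 rz_gt0 (z_ratio t).
have r1 : r <= 1.
  have le1 (a : nat) (b : bvec a) c : (0 < a)%N -> ones_ratio R b = c -> c <= 1.
    move=> a0 <-; rewrite /ones_ratio ler_pdivrMr ?ltr0n// mul1r ler_nat.
    by rewrite -[leqRHS]card_ord max_card.
  rewrite /r !mulr_ile1 ?mulr_ge0 ?(ltW rx_gt0) ?(ltW ry_gt0) ?(ltW rz_gt0)//.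
  - exact: le1 (n0 0%N) (x_ratio 0%N).
  - exact: le1 (m0 0%N) (y_ratio 0%N).
  - exact: le1 (l0 0%N) (z_ratio 0%N).
have rho1 : rho <= 1 by rewrite mulr_ile1 ?(ltW q0) ?(ltW r0)//; lra.
have mu0 : 0 <= mu by rewrite divr_ge0 ?(ltW rho0)// mulr_ge0//; lra.
have eps0 : 0 < eps by rewrite /eps divr_gt0// mulr_gt0 ?exprn_gt0// subr_gt0.
have eps_rho : eps <= rho / 2.
  have le1 : rho ^+ 3 * (1 - mu) <= rho * 1.
    apply: ler_pM; rewrite ?exprn_ge0 ?(ltW rho0) ?subr_ge0 ?(ltW mu1)//.
      by rewrite exprS ler_piMr ?(ltW rho0)// exprn_ile1 ?(ltW rho0).
    by lra.
  by rewrite /eps; lra.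
have small : mu + 75 * eps / rho ^+ 3 < 1.
  have -> : 75 * eps / rho ^+ 3 = (1 - mu) / 2.
    by rewrite /eps; field; rewrite gt_eqF.
  by lra.
have eps01 : 0 <= eps <= rho / 2 by rewrite (ltW eps0).
have eps2 : 0 <= eps <= 2 by rewrite (ltW eps0)//=; lra.
pose G (k : nat -> nat) t : R := (n t * m t * l t)%:R * expR (- (k t)%:R).
have lim : (fun t => 1 - (G m t + G n t + G n t)) @ \oo --> (1 : R).
  rewrite -[X in _ --> X](_ : 1 - (0 + 0 + 0) = 1); last by rewrite !addr0 subr0.
  by apply: cvgB; [exact: cvg_cst|apply: cvgD => //; exact: cvgD].
apply: squeeze_cvgr; [|exact: lim|exact: cvg_cst].
pose kappa := eps ^+ 2 / 8.
have k0 : 0 < kappa by rewrite divr_gt0// exprn_gt0.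
have Gn1 : \forall t \near \oo, G n t <= 1 by apply: (cvgr_le _ n_growth).
have Gm1 : \forall t \near \oo, G m t <= 1 by apply: (cvgr_le _ m_growth).
near=> t.
have nk : 8 <= kappa * (n t)%:R by near: t; exact: near_large.
have mk : 8 <= kappa * (m t)%:R by near: t; exact: near_large.
have lk : 8 <= kappa * (l t)%:R by near: t; exact: near_large.
have [nk4 mk4] : 4 <= kappa * (n t)%:R /\ 4 <= kappa * (m t)%:R by split; lra.
have gn : G n t <= 1 by near: t.
have gm : G m t <= 1 by near: t.
set W := rank1 (x t) (y t) (z t).
have [lo ->] := andP (noise_prob_compl W p_prob (fun g =>
  flp_recovers R (x t) (y t) (z t) (adversarial_input W (@A t) g))).
rewrite andbT; apply: le_trans lo; rewrite lerD2l lerN2.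
apply: le_trans _ (le_trans (noise_irregular W p_prob eps2) _).
  apply: (noise_prob_le _ p_prob) => g nrec cr; apply: nrec.
  apply: (regular_recovers (p := p) (eps := eps) (rho := rho) (rx := rx)
    (ry := ry) (rz := rz) (C := corrupted W g)) => //; first by rewrite p0.
  exact: corrupted_revert.
apply: lerD; first apply: lerD.
- exact: plane_tail_le.
- rewrite /G [(n t * m t)%N]mulnC; apply: plane_tail_le => //.
  by rewrite [(m t * n t)%N]mulnC.
- have E : (n t * m t * l t = l t * n t * m t)%N by rewrite mulnC mulnA.
  by rewrite /G E; apply: plane_tail_le => //; rewrite -E.
Unshelve. all: by end_near.
Qed.
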